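(* Let $A\in\mathbb C^{n\times n}$; let $z_1,z_2,\dots,z_N\in\mathbb C$ be arbitrary (possibly repeated) points of interpolation; let $f$ be an analytic function defined on a neighborhood of the convex hull of the union of the spectrum $\sigma(A)$ and the set $\{z_1,\dots,z_N\}$; let $r=\frac uv$ be a rational function of degree $[L/M]$, with $L\le N-1$, that interpolates $f$ at the points $z_1,\dots,z_N$ (counted according to their multiplicities); and let $v(z_k)\ne0$ for $k=1,2,\dots,N$ and $v(\lambda)\neq0$ for all $\lambda\in\sigma(A)$. Put $\Omega(z)=\prod_{k=1}^N(z-z_k)$. Then for any $b,d\in\mathbb C^n$, $$\bigl|d^H(f(A)-r(A))b\bigr|\le\max_{\substack{t\in[0,1]\\ \mu\in\operatorname{co}\{z_1,z_2,\dots,z_N\}}}\biggl|d^H\biggl[\Omega(A)[v(A)]^{-1}\frac{(vf)^{(N)}\bigl((1-t)\mu\mathbf 1+tA\bigr)}{N!}\biggr]b\biggr|.$$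
   Context: $\mathbf 1$ is the identity matrix, $d^H$ is the conjugate transpose of the column $d$, and $\operatorname{co}M$ is the convex hull of $M\subset\mathbb C$. If $g$ is analytic on an open (possibly disconnected) set containing $\sigma(B)$, then $g(B)=\frac1{2\pi i}\int_\Gamma g(\lambda)(\lambda\mathbf 1-B)^{-1}d\lambda$, where the contour $\Gamma$ encloses $\sigma(B)$; $(vf)^{(N)}$ is the $N$-th complex derivative of the product $vf$, and it is applied to the matrix $(1-t)\mu\mathbf 1+tA$ in this sense. A rational function $r=u/v$ of degree $[L/M]$ means that $u,v$ are polynomials with $\deg u\le L$, $\deg v\le M$. ''$r$ interpolates $f$ at $z_1,\dots,z_N$ counted according to their multiplicities'' means: if $\zeta_1,\dots,\zeta_m$ are the distinct values in the list $z_1,\dots,z_N$ and $n_k$ is the number of occurrences of $\zeta_k$ in the list (so $N=\sum_k n_k$), then $r^{(j)}(\zeta_k)=f^{(j)}(\zeta_k)$ for $k=1,\dots,m$, $j=0,1,\dots,n_k-1$. *)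

(* Defs.v *)
From HB Require Import structures.
From mathcomp Require Import all_boot all_order all_algebra.
From mathcomp Require Import complex.
From mathcomp Require Import all_classical all_reals all_analysis.

Set Implicit Arguments.
Unset Strict Implicit.
Unset Printing Implicit Defensive.

Import Order.TTheory GRing.Theory Num.Theory.
Import numFieldNormedType.Exports.

Local Open Scope classical_set_scope.
Local Open Scope ring_scope.
Local Open Scope complex_scope.

(* The topology and norm of C are those that every numFieldType carries as a
   normed module over itself, so that [derive1n] on functions R[i] -> R[i] is
   the complex derivative. *)
HB.instance Definition _ (R : realType) := NormedModule.copy R[i] R[i]^o.

Section definitions.
Context {R : realType}.
Local Notation C := R[i].

Definition analytic_at (f : C -> C) (z0 : C) :=
  exists (e : R) (a : nat -> C), 0 < e /\
    forall z, `|z - z0| < e%:C ->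
      series (fun k => a k * (z - z0) ^+ k) @ \oo --> f z.

Definition analytic_on (U : set C) (f : C -> C) :=
  forall z, U z -> analytic_at f z.

(* The convex weights are the w : C with 0 <= w <= 1, which in the order of
   R[i] are exactly the real numbers of [0, 1]. *)
Definition convex_hull (S : set C) : set C := smallest (@convex_set C C) S.

Definition spectrum n (B : 'M[C]_n) : set C := [set a | eigenvalue B a].

Definition cintegral (a b : R) (F : R -> C) : C :=
  (\int[lebesgue_measure]_(x in `[a, b]) complex.Re (F x)) +i*
  (\int[lebesgue_measure]_(x in `[a, b]) complex.Im (F x)).

(* Integral of F over the circle of centre D.1 and radius D.2, traversed once
   counterclockwise by t |-> D.1 + D.2 * exp(it), t in [0, 2 pi]. *)
Definition circle_integral (D : C * R) (F : C -> C) : C :=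
  cintegral 0 (2 * pi) (fun t =>
    F (D.1 + D.2%:C * (cos t +i* sin t)) *
    (D.2%:C * ((- sin t) +i* cos t))).

(* A contour is a finite family of circles D (centre D.1, radius D.2).  It
   encloses S within U when it bounds pairwise disjoint closed discs of U whose
   interiors cover S: its winding number is then 1 around the points of S and
   0 around the points outside U. *)
Definition contour : Type := seq (C * R).

Definition encloses (U S : set C) (G : contour) :=
  [/\ all (fun D : C * R => 0 < D.2) G,
      pairwise (fun D E : C * R => disj_set (closed_ball_ Num.norm D.1 D.2%:C)
                                           (closed_ball_ Num.norm E.1 E.2%:C)) G,
      forall D, D \in G -> closed_ball_ Num.norm D.1 D.2%:C `<=` U &
      forall s, S s -> exists2 D, D \in G & ball D.1 D.2%:C s].

Definition contour_integral (G : contour) (F : C -> C) : C :=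
  \sum_(D <- G) circle_integral D F.

(* g(B) for g analytic on the open set U containing the spectrum of B.  An
   enclosing contour exists because U is open and the spectrum is finite, and by
   Cauchy's theorem the integral does not depend on it, so that an arbitrary one
   is chosen; [::] is a dummy value. *)
Definition matfun n (U : set C) (g : C -> C) (B : 'M[C]_n) : 'M[C]_n :=
  let G := xget ([::] : contour) [set G | encloses U (spectrum B) G] in
  (2 * pi%:C * 'i)^-1 *:
    \matrix_(i, j)
      contour_integral G (fun l => g l * invmx (l%:M - B) i j).

Definition interpolates N (z : N.-tuple C) (r f : C -> C) :=
  forall (zeta : C) (j : nat), (j < count_mem zeta z)%N ->
    derive1n j r zeta = derive1n j f zeta.

Definition ratfun (u v : {poly C}) : C -> C := fun z => u.[z] / v.[z].

Definition nodal_poly N (z : N.-tuple C) : {poly C} :=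
  \prod_(k < N) ('X - (tnth z k)%:P).

Definition cform n (d : 'cV[C]_n) (X : 'M[C]_n) (b : 'cV[C]_n) : C :=
  ((map_mx conjc d)^T *m X *m b) ord0 ord0.

End definitions.

(* Main.v *)
Require Import Defs.
From HB Require Import structures.
From mathcomp Require Import all_boot all_order all_algebra.
From mathcomp Require Import complex.
From mathcomp Require Import all_classical all_reals all_analysis.
From mathcomp Require Import ring lra.
Import Order.TTheory GRing.Theory Num.Theory.
Import numFieldNormedType.Exports.
Local Open Scope classical_set_scope.
Local Open Scope ring_scope.
Local Open Scope complex_scope.

(** The functions of a matrix that occur in the statement are contour integrals,
but each of them is a polynomial in the matrix: if rs lists eigenvalues of B and
the product of the B - x, x in rs, is zero, then g(B) is the value at B of any
polynomial that has, at each x, the same derivatives as g up to the multiplicity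
of x in rs ([matfun_herm]).  Indeed the resolvent of B at l is the value at B of
the polynomial that interpolates w |-> 1 / (l - w) on rs, which makes it an
explicit combination of the functions 1 / (l - x)^(j+1), and Cauchy's formula on
each circle of the contour ([cauchy_formula_deriv], [cauchy_outside]) integrates
these against g.

Let now h = v f and Omega(x) = prod_k (x - z_k).  The interpolation conditions
say that u and h have the same derivatives at the nodes, up to their
multiplicities, and deg u < N; so u is
the remainder of the division by Omega of the Hermite interpolant P of h on the
nodes together with the eigenvalues.  Calling q the quotient,
v(A) (f(A) - r(A)) = P(A) - u(A) = Omega(A) q(A), and q(A) is the divided
difference h[z_1, ..., z_N, A].  The left-hand side of the theorem is therefore
the value at q of the linear form l(p) = d^H Omega(A) v(A)^-1 p(A) b.

What remains is the inequality that the Hermite-Genocchi integral formula would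
give,
   |l(h[z_1, ..., z_N, .])| <= max |l(h^(N)((1-t) mu + t .))| / N!,
and it is proved without multiple integrals, by induction on N
([ddiff_bound]).  Contract everything towards c = z_1: put
h_s(x) = h((1-s) c + s x) and phi(s) = h_s[z_1, ..., z_N, .].  As h_0 is
constant, phi(0) = 0; and d/ds h_s(x) = (x - c) h'((1-s) c + s x), so that the
node c cancels in the derivative and
   phi'(s) = (x |-> h'((1-s) c + s x))[z_2, ..., z_N, .].
The induction hypothesis bounds l(phi'(s)) by a multiple of s^(N-1), and the
mean value inequality turns this into the factor 1 / N ([mean_value_pow]).

Divided differences, and the matrices h^(N)((1-t) mu + t A), are finite linear
combinations of derivatives of h at finitely many points; hence they can be
differentiated in s, and they are continuous in (t, mu), so that the maximum
over the compact set [0, 1] x co{z_1, ..., z_N} is attained. *)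

Set Implicit Arguments.
Unset Strict Implicit.
Unset Printing Implicit Defensive.

(** * Modulus and limits in the complex plane *)

Section complex_plane.
Context {R : realType}.
Local Notation C := R[i].
Implicit Types (x y z : C).

Lemma cReD x y : complex.Re (x + y) = complex.Re x + complex.Re y.
Proof. by case: x y => [? ?] [? ?]. Qed.
Lemma cImD x y : complex.Im (x + y) = complex.Im x + complex.Im y.
Proof. by case: x y => [? ?] [? ?]. Qed.
Lemma cReN x : complex.Re (- x) = - complex.Re x.
Proof. by case: x. Qed.
Lemma cImN x : complex.Im (- x) = - complex.Im x.
Proof. by case: x. Qed.
Lemma cReM x y : complex.Re (x * y) =
  complex.Re x * complex.Re y - complex.Im x * complex.Im y.
Proof. by case: x y => [? ?] [? ?]. Qed.
Lemma cImM x y : complex.Im (x * y) =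
  complex.Re x * complex.Im y + complex.Im x * complex.Re y.
Proof. by case: x y => [? ?] [? ?]. Qed.

Lemma complexP x y :
  complex.Re x = complex.Re y -> complex.Im x = complex.Im y -> x = y.
Proof. by case: x y => [? ?] [? ?] /= -> ->. Qed.

(** The norm of R[i] takes its values in R[i]; estimates are carried out in R. *)
Definition cabs (z : C) : R := complex.Re `|z|.

Lemma cabsE z : (cabs z)%:C = `|z|.
Proof. by rewrite /cabs normc_def. Qed.

Lemma cabs_ge0 z : 0 <= cabs z.
Proof. rewrite -(lecR 0) cabsE; exact: normr_ge0. Qed.

Lemma RtoC_inj : injective (fun r : R => r%:C).
Proof. by move=> r s []. Qed.

Lemma cabsM x y : cabs (x * y) = cabs x * cabs y.
Proof. by apply: RtoC_inj; rewrite rmorphM /= !cabsE normrM. Qed.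

Lemma cabsD x y : cabs (x + y) <= cabs x + cabs y.
Proof. by rewrite -lecR rmorphD /= !cabsE ler_normD. Qed.

Lemma cabsN x : cabs (- x) = cabs x.
Proof. by rewrite /cabs normrN. Qed.

Lemma cabs_dist x y : `|cabs x - cabs y| <= cabs (x - y).
Proof.
rewrite ler_norml; apply/andP; split.
  by rewrite lerBrDl lerBlDr -(cabsN (x - y)) opprB (le_trans _ (cabsD _ _)) // addrC subrK.
by rewrite lerBlDr (le_trans _ (cabsD _ _)) // subrK.
Qed.

Lemma cabs_real (r : R) : cabs r%:C = `|r|.
Proof. by apply: RtoC_inj; rewrite cabsE normc_def /= expr0n addr0 sqrtr_sqr. Qed.

Lemma cabs_Re z : `|complex.Re z| <= cabs z.
Proof. by rewrite -lecR cabsE normc_ge_Re. Qed.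

Lemma cabs_Im z : `|complex.Im z| <= cabs z.
Proof.
rewrite /cabs normc_def /= -sqrtr_sqr ler_wsqrtr //.
by rewrite lerDr sqr_ge0.
Qed.

Lemma cabs_le_ReIm z : cabs z <= `|complex.Re z| + `|complex.Im z|.
Proof.
have {1}-> : z = (complex.Re z)%:C + 'i * (complex.Im z)%:C.
  by apply: complexP; rewrite ?cReD ?cImD ?cReM ?cImM /=; ring.
rewrite (le_trans (cabsD _ _)) // cabsM !cabs_real.
have -> : cabs 'i = 1 by rewrite /cabs normc_def /= expr0n add0r expr1n sqrtr1.
by rewrite mul1r.
Qed.

Lemma gt0_complex (e : C) : 0 < e -> e = (complex.Re e)%:C /\ 0 < complex.Re e.
Proof. by case: e => a b; rewrite ltcE /= => /andP[/eqP -> ->]. Qed.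

Lemma cvgC_cabs {T : Type} {F : set_system T} {FF : Filter F} (f : T -> C) (l : C) :
  f @ F --> l <-> forall e : R, 0 < e -> \forall t \near F, cabs (l - f t) < e.
Proof.
split.
  move=> /cvgrPdist_lt h e e0; have := h e%:C; rewrite ltcR => /(_ e0).
  by apply: filterS => t; rewrite -cabsE ltcR.
move=> h; apply/cvgrPdist_lt => e /gt0_complex[-> e0].
by apply: filterS (h _ e0) => t; rewrite -cabsE ltcR.
Qed.

Lemma cvgC {T : Type} {F : set_system T} {FF : Filter F} (f : T -> C) (l : C) :
  f @ F --> l <->
  (complex.Re (f t) @[t --> F] --> complex.Re l) /\
  (complex.Im (f t) @[t --> F] --> complex.Im l).
Proof.
split.
  move=> /cvgC_cabs h; split; apply/cvgrPdist_lt => e /h; apply: filterS => t;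
    apply: le_lt_trans; rewrite -?cReN -?cImN -?cReD -?cImD ?cabs_Re ?cabs_Im //.
move=> [/cvgrPdist_lt h1 /cvgrPdist_lt h2]; apply/cvgC_cabs => e e0.
have e2 : 0 < e / 2 by rewrite divr_gt0.
near=> t; rewrite (le_lt_trans (cabs_le_ReIm _)) // [e]splitr ltrD //.
  by rewrite cReD cReN; near: t; exact: h1.
by rewrite cImD cImN; near: t; exact: h2.
Unshelve. all: by end_near. Qed.

Lemma continuousC {T : topologicalType} (f : T -> C) t :
  {for t, continuous f} <->
  {for t, continuous (@complex.Re R \o f)} /\ {for t, continuous (@complex.Im R \o f)}.
Proof. exact: cvgC. Qed.

Lemma continuous_cabs {T : topologicalType} (f : T -> C) t :
  {for t, continuous f} -> {for t, continuous (cabs \o f)}.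
Proof.
move=> /cvgC_cabs cf; apply/cvgrPdist_lt => e /cf; apply: filterS => s.
apply: le_lt_trans; exact: cabs_dist.
Qed.

(** Instances of the generic limit rules at R[i], whose structure unification
does not find by itself when the source is R or a product. *)
Lemma cvgCM {T : Type} {F : set_system T} {FF : Filter F} (f g : T -> C) (a b : C) :
  f @ F --> a -> g @ F --> b -> (f t * g t) @[t --> F] --> a * b.
Proof. exact: (@cvgM C T F FF f g a b). Qed.

Lemma cvgCD {T : Type} {F : set_system T} {FF : Filter F} (f g : T -> C) (a b : C) :
  f @ F --> a -> g @ F --> b -> (f t + g t) @[t --> F] --> a + b.
Proof. exact: (@cvgD C C T F FF f g a b). Qed.

Lemma cvgCN {T : Type} {F : set_system T} {FF : Filter F} (f : T -> C) (a : C) :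
  f @ F --> a -> (- f t) @[t --> F] --> - a.
Proof. exact: (@cvgN C C T F FF f a). Qed.

Lemma cvgCV {T : Type} {F : set_system T} {FF : Filter F} (f : T -> C) (a : C) :
  a != 0 -> f @ F --> a -> (f t)^-1 @[t --> F] --> a^-1.
Proof. exact: (@cvgV C T F FF f a). Qed.

Lemma cvgC_real {T : Type} {F : set_system T} {FF : Filter F} (f : T -> R) (a : R) :
  f @ F --> a -> (f t)%:C @[t --> F] --> a%:C.
Proof. by move=> fa; apply/cvgC; split => //; exact: cvg_cst. Qed.

Section continuousC_arith.
Context {T : topologicalType} {x : T} {f g : T -> C}.

Lemma contCM : {for x, continuous f} -> {for x, continuous g} ->
  {for x, continuous (fun t => f t * g t)}.
Proof. exact: (@cvgCM T (nbhs x) (nbhs_filter x) f g). Qed.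

Lemma contCD : {for x, continuous f} -> {for x, continuous g} ->
  {for x, continuous (fun t => f t + g t)}.
Proof. exact: (@cvgCD T (nbhs x) (nbhs_filter x) f g). Qed.

End continuousC_arith.

End complex_plane.

(** * Derivatives in the slope form *)

(** Caratheodory's form of the derivative: chain and product rules become
identities between slope functions, for functions of a complex and of a real
variable alike. *)
Lemma is_derive_slopeP (K : numFieldType) (f : K -> K) (x l : K) :
  is_derive x 1 f l <->
  exists q : K -> K, [/\ {for x, continuous q}, q x = l &
                     forall y, f y - f x = q y * (y - x)].
Proof.
split.
  move=> [df <-].
  exists (fun y => if y == x then 'D_1 f x else (f y - f x) / (y - x)).
  split; last 1 first.
  - move=> y; case: eqP => [->|/eqP yx]; first by rewrite !subrr mulr0.
    by rewrite divfK // subr_eq0.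
  - rewrite /prop_for /continuous_at eqxx.
    have : h^-1 *: (f (h *: 1 + x) - f x) @[h --> 0^'] --> 'D_1 f x by exact: df.
    move=> /cvgrPdist_lt h; apply/(@cvgrPdist_lt K K^o _ _ (nbhs_filter x)) => e e0.
    have := h e e0; rewrite /dnbhs near_withinE => hn.
    have h2 : \forall y \near x, y - x != 0 ->
       `|'D_1 f x - (y - x)^-1 *: (f ((y - x) *: 1 + x) - f x)| < e.
      have : (y - x) @[y --> x] --> (0 : K).
        by rewrite -(subrr x); apply: (@cvgB K K^o _ _ (nbhs_filter x)); [exact: cvg_id|exact: cvg_cst].
      by move=> /(_ _ hn).
    apply: filterS h2 => y; rewrite subr_eq0 /=.
    case: (eqVneq y x) => [_ _|yx /(_ isT)]; first by rewrite subrr normr0.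
    rewrite scaler1 subrK.
    by rewrite /GRing.scale /= [_^-1 * _]mulrC.
  - by rewrite eqxx.
move=> [q [cq <- fq]].
have cv : h^-1 *: (f (h *: 1 + x) - f x) @[h --> 0^'] --> q x.
  have e1 : \forall h \near (0:K), h != 0 -> q (h + x) = h^-1 *: (f (h *: 1 + x) - f x).
    apply: (@filterE _ _ (nbhs_filter (0:K))) => h h0.
    by rewrite fq scaler1 addrK /GRing.scale /= mulrCA mulVf // mulr1.
  apply: cvg_trans (near_eq_cvg e1) _.
  apply: cvg_within_filter.
  have : (h + x) @[h --> (0 : K)] --> x.
    by rewrite -[X in _ --> X]add0r; apply: (@cvgD K K^o _ _ (nbhs_filter (0 : K))); [exact: cvg_id|exact: cvg_cst].
  by move=> /cvg_comp; apply.
apply: DeriveDef.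
  by apply/cvg_ex; exists (q x).
exact/cvg_lim.
Unshelve. all: by end_near. Qed.

Lemma is_derive_compK (K : numFieldType) (f g : K -> K) (x a b : K) :
  is_derive (g x) 1 f a -> is_derive x 1 g b -> is_derive x 1 (f \o g) (a * b).
Proof.
move=> /is_derive_slopeP[q [cq qx fq]] /is_derive_slopeP[p [cp px gp]].
have cg : {for x, continuous g}.
  rewrite (_ : g = (fun y => g x + p y * (y - x))); last first.
    by apply/funext => y; rewrite -gp addrC subrK.
  apply: (@cvgD K K^o _ _ (nbhs_filter x)); first exact: cvg_cst.
  apply: (@cvgM K _ _ (nbhs_filter x)) => //.
  by apply: (@cvgB K K^o _ _ (nbhs_filter x)); [exact: cvg_id|exact: cvg_cst].
apply/is_derive_slopeP; exists (fun y => q (g y) * p y); split.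
- apply: (@cvgM K _ _ (nbhs_filter x)) => //.
  exact: (continuous_comp cg cq).
- by rewrite qx px.
- by move=> y /=; rewrite fq gp mulrA.
Qed.

Section curves.
Context {R : realType}.
Local Notation C := R[i].

(** The derivative of a curve in C is taken componentwise, because R[i] is a
normed module over itself and not over R. *)
Definition cderive (F : R -> C) (t : R) (w : C) :=
  is_derive t 1 (@complex.Re R \o F) (complex.Re w) /\
  is_derive t 1 (@complex.Im R \o F) (complex.Im w).

Lemma cderive_slopeP (F : R -> C) (t : R) (w : C) :
  cderive F t w <->
  exists q : R -> C, [/\ {for t, continuous q}, q t = w &
                     forall s, F s - F t = q s * (s - t)%:C].
Proof.
split.
  move=> [/is_derive_slopeP[q [cq qx fq]] /is_derive_slopeP[p [cp px gp]]].
  exists (fun s => q s +i* p s); split.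
  - by apply/continuousC; split.
  - by rewrite qx px; case: (w).
  - move=> s; apply: complexP; rewrite ?cReD ?cImD ?cReM ?cImM ?cReN ?cImN /=.
      by rewrite fq mulr0 subr0.
    by rewrite gp mulr0 add0r.
move=> [q [/continuousC[cq cp] <- fq]]; split; apply/is_derive_slopeP.
  exists (@complex.Re R \o q); split => // s.
  by rewrite /= -cReN -cReD fq cReM /= mulr0 subr0.
exists (@complex.Im R \o q); split => // s.
by rewrite /= -cImN -cImD fq cImM /= mulr0 add0r.
Qed.

Lemma cderive_continuous F t w : cderive F t w -> {for t, continuous F}.
Proof.
move=> [[dr _] [di _]]; apply/continuousC; split.
  by apply: differentiable_continuous; apply/derivable1_diffP.
by apply: differentiable_continuous; apply/derivable1_diffP.
Qed.

Lemma cderive_comp (f : C -> C) (F : R -> C) t l w :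
  is_derive (F t) 1 f l -> cderive F t w -> cderive (f \o F) t (l * w).
Proof.
move=> /is_derive_slopeP[q [cq qx fq]] dF; have cF := cderive_continuous dF.
have /cderive_slopeP[p [cp px gp]] := dF.
apply/cderive_slopeP; exists (fun y => q (F y) * p y); split.
- have c1 : q (F s) @[s --> t] --> q (F t).
    exact: (cvg_comp F q cF cq).
  exact: (cvgCM c1 cp).
- by rewrite qx px.
- by move=> y /=; rewrite fq gp mulrA.
Qed.

Lemma cderive_cst (c : C) t : cderive (fun=> c) t 0.
Proof. by split; exact: is_derive_cst. Qed.

Lemma cderive_real (r : R -> R) (t r' : R) :
  is_derive t 1 r r' -> cderive (fun s => (r s)%:C) t r'%:C.
Proof. by move=> dr; split => //; exact: is_derive_cst. Qed.

Lemma cderiveD F G t w v :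
  cderive F t w -> cderive G t v -> cderive (fun s => F s + G s) t (w + v).
Proof.
move=> [a b] [c d]; split; rewrite ?cReD ?cImD.
  have -> : @complex.Re R \o (fun s => F s + G s) = (@complex.Re R \o F) + (@complex.Re R \o G).
    by apply/funext => s /=; rewrite cReD.
  exact: is_deriveD.
have -> : @complex.Im R \o (fun s => F s + G s) = (@complex.Im R \o F) + (@complex.Im R \o G).
  by apply/funext => s /=; rewrite cImD.
exact: is_deriveD.
Qed.

Lemma cderiveM F G t w v :
  cderive F t w -> cderive G t v ->
  cderive (fun s => F s * G s) t (w * G t + F t * v).
Proof.
move=> dF dG; have cF := cderive_continuous dF.
have /cderive_slopeP[p [cp <- gp]] := dF.
have /cderive_slopeP[q [cq <- gq]] := dG.
apply/cderive_slopeP; exists (fun s => p s * G t + F s * q s); split.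
- have cG : (fun=> G t) @ t --> G t by exact: cvg_cst.
  exact: (cvgCD (cvgCM cp cG) (cvgCM cF cq)).
- by [].
- move=> s; transitivity ((F s - F t) * G t + F s * (G s - G t)); first by ring.
  by rewrite gp gq; ring.
Qed.

Lemma cderiveZ (c : C) F t w : cderive F t w -> cderive (fun s => c * F s) t (c * w).
Proof. by move=> /(cderiveM (cderive_cst c t)); rewrite mul0r add0r. Qed.

Lemma cderive_sum (I : Type) (r : seq I) (F : I -> R -> C) t (w : I -> C) :
  (forall i, cderive (F i) t (w i)) ->
  cderive (fun s => \sum_(i <- r) F i s) t (\sum_(i <- r) w i).
Proof.
move=> dF; elim: r => [|i r ih].
  rewrite big_nil; under eq_fun do rewrite big_nil; exact: cderive_cst.
by rewrite big_cons; under eq_fun do rewrite big_cons; exact: cderiveD.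
Qed.

Lemma is_derive_affine (p q x : C) : is_derive x 1 (fun y => p + q * y) q.
Proof.
apply/is_derive_slopeP; exists (fun=> q); split; [exact: (@cst_continuous C C q x)|by []|].
by move=> y; ring.
Qed.

Lemma is_deriveC_V (x : C) : x != 0 -> is_derive x 1 (fun y : C => y^-1) (- x ^- 2).
Proof.
move=> x0.
have dx : derivable (fun y : C => y^-1) x 1.
  by apply: (@derivableV _ _ id) => //; exact: derivable_id.
have := @deriveV C C id x 1 x0 (@derivable_id C C x 1).
by rewrite derive_id /GRing.scale /= mulr1 => e; exact: DeriveDef.
Qed.

End curves.

Section more_derive.
Context {R : realType}.
Local Notation C := R[i].

Lemma is_deriveCM (f g : C -> C) (x df dg : C) :
  is_derive x 1 f df -> is_derive x 1 g dg ->
  is_derive x 1 (fun y => f y * g y) (df * g x + f x * dg).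
Proof.
move=> hf hg; have := is_deriveM hf hg.
by rewrite /GRing.scale /= addrC [g x * df]mulrC.
Qed.

Lemma is_deriveCD (f g : C -> C) (x df dg : C) :
  is_derive x 1 f df -> is_derive x 1 g dg ->
  is_derive x 1 (fun y => f y + g y) (df + dg).
Proof. by move=> hf hg; have := is_deriveD hf hg. Qed.

Lemma is_deriveC_cst (c x : C) : is_derive x 1 (fun=> c) (0 : C).
Proof. exact: is_derive_cst. Qed.

Lemma is_deriveC_subr (a x : C) : is_derive x 1 (fun y => y - a) (1 : C).
Proof.
have := is_derive_affine (- a) 1 x.
by rewrite (_ : (fun y => _) = (fun y => y - a)) //; apply/funext => y; rewrite mul1r addrC.
Qed.

Lemma is_deriveC_continuous (f : C -> C) (x df : C) :
  is_derive x 1 f df -> {for x, continuous f}.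
Proof.
move=> [d _]; have /derivable1_diffP : derivable f x 1 by exact: d.
exact: differentiable_continuous.
Qed.

Lemma is_derive_invsub (a x : C) (k : nat) : x != a ->
  is_derive x 1 (fun y => (y - a)^-1 ^+ k) (- k%:R * (x - a)^-1 ^+ k.+1).
Proof.
move=> xa; have xa0 : x - a != 0 by rewrite subr_eq0.
have d1 : is_derive x 1 (fun y => (y - a)^-1) (- (x - a)^-1 ^+ 2).
  have := @is_derive_compK C (fun y => y^-1) (fun y => y - a) x _ _ (is_deriveC_V xa0) (is_deriveC_subr a x).
  by rewrite mulr1 exprVn.
elim: k => [|k ih].
  by rewrite oppr0 mul0r (_ : (fun y => _) = fun=> 1) //; exact: is_deriveC_cst.
have := is_deriveCM d1 ih.
rewrite (_ : (fun y => (y - a)^-1 * (y - a)^-1 ^+ k) = (fun y => (y - a)^-1 ^+ k.+1));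
  last by apply/funext => y; rewrite exprS.
move: (x - a)^-1 => w.
rewrite (_ : - w ^+ 2 * _ + _ = - k.+1%:R * w ^+ k.+2) //.
by rewrite -natr1 !exprS; ring.
Qed.

End more_derive.

(** * Integrals of complex-valued functions of a real variable *)

Section integral.
Context {R : realType}.
Local Notation C := R[i].
Local Notation mu := lebesgue_measure.

Lemma continuous_integrable (f : R -> R) (a b : R) :
  continuous f -> mu.-integrable `[a, b] (EFin \o f).
Proof.
move=> cf; apply: continuous_compact_integrable; first exact: segment_compact.
exact: continuous_subspaceT.
Qed.

Lemma Rintegral_FTC (F f : R -> R) (a b : R) : a < b ->
  continuous f -> (forall x : R, is_derive x 1 F (f x)) ->
  \int[mu]_(x in `[a, b]) f x = F b - F a.
Proof.
move=> ab cf dF.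
have cF : continuous F.
  move=> x; apply: differentiable_continuous; apply/derivable1_diffP.
  by have [] := dF x.
rewrite /Rintegral (@continuous_FTC2 _ f F) //.
- exact: continuous_subspaceT.
- split; first by move=> x _; have [] := dF x.
    by apply: cvg_at_right_filter; exact: cF.
  by apply: cvg_at_left_filter; exact: cF.
- by move=> x _; rewrite derive1E; have [_ ->] := dF x.
Qed.

(** The bound required by differentiation under the integral sign comes from the
continuity of f' on a compact rectangle. *)
Lemma Rintegral_param (f f' : R -> R -> R) (a b : R) (t0 : R) :
  (forall t, continuous (f t)) ->
  continuous (fun p : R * R => f' p.1 p.2) ->
  (forall t x : R, is_derive t 1 (f ^~ x) (f' t x)) ->
  is_derive t0 1 (fun t => \int[mu]_(x in `[a, b]) f t x)
                 (\int[mu]_(x in `[a, b]) f' t0 x).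
Proof.
move=> cf cf' df.
have [M [_ hM]] : bounded_set
    ((fun p : R * R => f' p.1 p.2) @` (`[t0 - 1, t0 + 1] `*` `[a, b])).
  apply: compact_bounded; apply: continuous_compact.
    exact: continuous_subspaceT.
  by apply: compact_setX; exact: segment_compact.
pose G (_ : R) := M + 1 + `|M|.
have Gge0 x : 0 <= G x by rewrite /G; have := ler_norm (- M); rewrite normrN; lra.
have d1 t x : partial1of2 f t x = f' t x.
  by rewrite partial1of2E; have [_ ->] := df t x.
have It0 : t0 \in `]t0 - 1, t0 + 1[.
  by rewrite in_itv /=; apply/andP; split; lra.
have Iint t : `]t0 - 1, t0 + 1[%classic t -> mu.-integrable `[a, b] (EFin \o f t).
  by move=> _; exact: continuous_integrable.
have Ider t x : `]t0 - 1, t0 + 1[%classic t -> `[a, b]%classic x -> derivable (f ^~ x) t 1.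
  by move=> _ _; have [] := df t x.
have IG : mu.-integrable `[a, b] (EFin \o G).
  by apply: continuous_integrable => x; exact: cvg_cst.
have Gub t x : `]t0 - 1, t0 + 1[%classic t -> `[a, b]%classic x ->
    `|partial1of2 f t x| <= G x.
  move=> tI xI; rewrite d1; apply: (hM (G x)).
    by rewrite /G; have := normr_ge0 M; lra.
  exists (t, x) => //; split => //=.
  exact: subset_itv_oo_cc.
have mab : measurable (`[a, b]%classic : set (measurableTypeR R)) by exact: measurable_itv.
apply: DeriveDef.
  exact: (derivable_under_integral mab It0 Iint Ider Gge0 IG Gub).
rewrite -derive1E (differentiation_under_integral mab It0 Iint Ider Gge0 IG Gub).
by apply: eq_Rintegral => x _; rewrite d1.
Qed.

Lemma continuous_Re (T : topologicalType) (F : T -> C) :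
  continuous F -> continuous (fun t => complex.Re (F t)).
Proof. by move=> cF t; have /continuousC[] := cF t. Qed.

Lemma continuous_Im (T : topologicalType) (F : T -> C) :
  continuous F -> continuous (fun t => complex.Im (F t)).
Proof. by move=> cF t; have /continuousC[] := cF t. Qed.

Lemma eq_cintegral (a b : R) (F G : R -> C) :
  F =1 G -> cintegral a b F = cintegral a b G.
Proof. by move=> /funext ->. Qed.

Lemma cintegral0 (a b : R) : cintegral a b (fun=> 0 : C) = 0.
Proof.
by rewrite /cintegral !Rintegral_cst ?mul0r.
Qed.

Lemma cintegralD (a b : R) (F G : R -> C) : continuous F -> continuous G ->
  cintegral a b (fun t => F t + G t) = cintegral a b F + cintegral a b G.
Proof.
move=> cF cG; have mab : measurable (`[a, b]%classic : set (measurableTypeR R)) by exact: measurable_itv.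
have iF := continuous_integrable a b (continuous_Re cF).
have iG := continuous_integrable a b (continuous_Re cG).
have jF := continuous_integrable a b (continuous_Im cF).
have jG := continuous_integrable a b (continuous_Im cG).
apply: complexP; rewrite ?cReD ?cImD /=.
  by rewrite -(RintegralD mab iF iG); apply: eq_Rintegral => x _; rewrite cReD.
by rewrite -(RintegralD mab jF jG); apply: eq_Rintegral => x _; rewrite cImD.
Qed.

Lemma cintegralZ (a b : R) (c : C) (F : R -> C) : continuous F ->
  cintegral a b (fun t => c * F t) = c * cintegral a b F.
Proof.
move=> cF; have mab : measurable (`[a, b]%classic : set (measurableTypeR R)) by exact: measurable_itv.
have iR := continuous_integrable a b (continuous_Re cF).
have iI := continuous_integrable a b (continuous_Im cF).
have icR (r : R) : mu.-integrable `[a, b] (EFin \o (fun t => r * complex.Re (F t))).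
  apply: continuous_integrable => t; apply: cvgM; [exact: cvg_cst|exact: continuous_Re].
have icI (r : R) : mu.-integrable `[a, b] (EFin \o (fun t => r * complex.Im (F t))).
  apply: continuous_integrable => t; apply: cvgM; [exact: cvg_cst|exact: continuous_Im].
apply: complexP; rewrite ?cReM ?cImM /= -!RintegralZl //.
  rewrite -RintegralB //.
  by apply: eq_Rintegral => x _; rewrite cReM.
rewrite -RintegralD //.
by apply: eq_Rintegral => x _; rewrite cImM.
Qed.

Lemma cintegral_sum (I : Type) (r : seq I) (a b : R) (F : I -> R -> C) :
  (forall i, continuous (F i)) ->
  cintegral a b (fun t => \sum_(i <- r) F i t) = \sum_(i <- r) cintegral a b (F i).
Proof.
move=> cF; elim: r => [|i r ih].
  by rewrite big_nil; under eq_cintegral do rewrite big_nil; rewrite cintegral0.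
have cS : continuous (fun t => \sum_(j <- r) F j t).
  elim: r {ih} => [|j r ih] t.
    have -> : (fun t => \sum_(j <- [::]) F j t) = fun=> 0.
      by apply/funext => u; rewrite big_nil.
    exact: cst_continuous.
  have -> : (fun t => \sum_(k <- j :: r) F k t) = (fun t => F j t + \sum_(k <- r) F k t).
    by apply/funext => u; rewrite big_cons.
  exact: (cvgCD (cF j t) (ih t)).
under eq_cintegral do rewrite big_cons.
by rewrite big_cons (cintegralD a b (cF i) cS) ih.
Qed.

Lemma cintegral_FTC (F f : R -> C) (a b : R) : a < b ->
  continuous f -> (forall x, cderive F x (f x)) ->
  cintegral a b f = F b - F a.
Proof.
move=> ab cf dF; apply: complexP; rewrite ?cReD ?cImD ?cReN ?cImN /=.
  exact: (Rintegral_FTC ab (continuous_Re cf) (fun x => (dF x).1)).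
exact: (Rintegral_FTC ab (continuous_Im cf) (fun x => (dF x).2)).
Qed.

(** The only form of dependence on a parameter that Cauchy's theorem needs: an
integral does not change when its derivative in the parameter integrates to
zero. *)
Lemma cintegral_param_cst (f f' : R -> R -> C) (a b : R) (s t : R) :
  (forall t, continuous (f t)) ->
  continuous (fun p : R * R => f' p.1 p.2) ->
  (forall t x, cderive (f ^~ x) t (f' t x)) ->
  (forall t, cintegral a b (f' t) = 0) ->
  cintegral a b (f s) = cintegral a b (f t).
Proof.
move=> cf cf' df I0; apply: complexP => /=.
  apply: (@is_derive_0_is_cst _ (fun t => \int[mu]_(x in `[a, b]) complex.Re (f t x))).
  move=> r; have <- : \int[mu]_(x in `[a, b]) complex.Re (f' r x) = 0.
    by have [] := I0 r.
  apply: (@Rintegral_param (fun t x => complex.Re (f t x)) (fun t x => complex.Re (f' t x))).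
  - by move=> u; exact: continuous_Re.
  - exact: (continuous_Re cf').
  - by move=> u x; have [] := df u x.
apply: (@is_derive_0_is_cst _ (fun t => \int[mu]_(x in `[a, b]) complex.Im (f t x))).
move=> r; have <- : \int[mu]_(x in `[a, b]) complex.Im (f' r x) = 0.
  by have [] := I0 r.
apply: (@Rintegral_param (fun t x => complex.Im (f t x)) (fun t x => complex.Im (f' t x))).
- by move=> u; exact: continuous_Im.
- exact: (continuous_Im cf').
- by move=> u x; have [] := df u x.
Qed.

End integral.

(** * Cauchy's formula on a circle *)

Section circle.
Context {R : realType}.
Local Notation C := R[i].
Variables (c : C) (rho : R).
Hypothesis rho_gt0 : 0 < rho.

(** These are the curve and the velocity of [circle_integral]. *)
Definition circ (t : R) : C := c + rho%:C * (cos t +i* sin t).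
Definition dcirc (t : R) : C := rho%:C * ((- sin t) +i* cos t).

Lemma cderive_circ t : cderive circ t (dcirc t).
Proof.
rewrite -[dcirc t]add0r; apply: cderiveD; first exact: cderive_cst.
apply: cderiveZ; split => /=; [exact: is_derive_cos|exact: is_derive_sin].
Qed.

Lemma continuous_circ : continuous circ.
Proof. by move=> t; exact: cderive_continuous (cderive_circ t). Qed.

Lemma continuous_dcirc : continuous dcirc.
Proof.
move=> t; apply: cvgCM; first exact: cvg_cst.
apply/cvgC; split; last exact: continuous_cos.
by apply: cvgN; exact: continuous_sin.
Qed.

Lemma circ_2pi : circ (2 * pi) = circ 0.
Proof. by rewrite /circ mulr_natl cos2pi sin2pi cos0 sin0. Qed.

Lemma cabs_circ t : cabs (circ t - c) = rho.
Proof.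
rewrite /circ addrC addKr cabsM cabs_real gtr0_norm //.
by rewrite /cabs normc_def /= cos2Dsin2 sqrtr1 mulr1.
Qed.

Lemma dcircE t : dcirc t = 'i * (circ t - c).
Proof.
rewrite /circ addrC addKr /dcirc mulrCA; congr (_ * _).
by apply: complexP; rewrite ?cReM ?cImM /=; ring.
Qed.

Lemma circ_neq b t : cabs (b - c) < rho -> circ t != b.
Proof.
by move=> bD; apply/eqP => e; move: (cabs_circ t); rewrite e => e'; rewrite e' ltxx in bD.
Qed.

Lemma circle_integralE (F : C -> C) :
  circle_integral (c, rho) F = cintegral 0 (2 * pi) (fun t => F (circ t) * dcirc t).
Proof. by []. Qed.

Lemma circle_integral_primitive (F f : C -> C) :
  (forall t, is_derive (circ t) 1 F (f (circ t))) ->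
  continuous (fun t => f (circ t)) ->
  circle_integral (c, rho) f = 0.
Proof.
move=> dF cf; rewrite circle_integralE (@cintegral_FTC _ (F \o circ)).
- by rewrite /= circ_2pi subrr.
- by rewrite mulr_gt0 ?pi_gt0.
- by move=> t; apply: cvgCM; [exact: cf|exact: continuous_dcirc].
- by move=> t; exact: (cderive_comp (dF t) (cderive_circ t)).
Qed.

Lemma continuous2_snd (g : R -> C) :
  continuous g -> continuous (fun p : R * R => g p.2).
Proof. by move=> cg p; apply: (cvg_comp _ _ (@cvg_snd _ _ _ _ _)); exact: cg. Qed.

Lemma continuous2_fst (g : R -> C) :
  continuous g -> continuous (fun p : R * R => g p.1).
Proof. by move=> cg p; apply: (cvg_comp _ _ (@cvg_fst _ _ _ _ _)); exact: cg. Qed.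

Lemma cderive_sin t : cderive (fun s => (sin s)%:C : C) t (cos t)%:C.
Proof. by apply: cderive_real; exact: is_derive_sin. Qed.

Lemma continuousC_real (g : R -> R) : continuous g -> continuous (fun t => (g t)%:C : C).
Proof. by move=> cg t; apply: cvgC_real; exact: cg. Qed.

Lemma cabs_sin_le (t : R) (x : C) : cabs ((sin t)%:C * x) <= cabs x.
Proof.
rewrite cabsM cabs_real ler_piMl ?cabs_ge0 // ler_norml sin_geN1 sin_le1 //.
Qed.

(** Moving the pole radially to the centre does not change the integral, its
derivative being the integral of an exact form; with the pole at the centre the
integrand is constant. *)
Lemma circle_integral_pole (a : C) : cabs (a - c) < rho ->
  circle_integral (c, rho) (fun l => (l - a)^-1) = 2 * pi%:C * 'i.
Proof.
(* The sine makes the parameter range over the whole line while the pole stays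
   in the disc; it is at the centre for s = 0 and at a for s = pi / 2. *)
move=> aD; pose b s := c + (sin s)%:C * (a - c).
have bD s : cabs (b s - c) < rho.
  by rewrite /b addrC addKr (le_lt_trans (cabs_sin_le _ _)).
have nz s t : circ t - b s != 0 by rewrite subr_eq0 circ_neq.
pose F s t := (circ t - b s)^-1 * dcirc t.
pose F' s t := (cos s)%:C * (a - c) * ((circ t - b s)^-1 ^+ 2 * dcirc t).
have db s : cderive b s ((cos s)%:C * (a - c)).
  have := cderiveD (cderive_cst c s) (cderiveM (cderive_sin s) (cderive_cst (a - c) s)).
  by rewrite add0r mulr0 addr0.
have cb : continuous b by move=> s; exact: cderive_continuous (db s).
have cw : continuous (fun p : R * R => (circ p.2 - b p.1)^-1).
  move=> p; apply: cvgCV; first exact: nz.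
  apply: cvgCD; first exact: (continuous2_snd continuous_circ).
  by apply: cvgCN; exact: (continuous2_fst cb).
have cwt s : continuous (fun t => (circ t - b s)^-1).
  move=> t; apply: cvgCV; first exact: nz.
  by apply: cvgCD; [exact: continuous_circ|exact: cvg_cst].
have -> : circle_integral (c, rho) (fun l => (l - a)^-1) = cintegral 0 (2 * pi) (F (pi / 2)).
  by rewrite circle_integralE /F /b sin_pihalf mul1r addrC subrK.
rewrite (@cintegral_param_cst _ F F' 0 (2 * pi) (pi / 2) 0).
- rewrite (_ : F 0 = fun=> 'i); last first.
    apply/funext => t; rewrite /F /b sin0 mul0r addr0 dcircE mulrCA mulVf ?mulr1 //.
    by have := nz 0 t; rewrite /b sin0 mul0r addr0.
  rewrite (@cintegral_FTC _ (fun t => t%:C * 'i)).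
  - by rewrite mul0r subr0 rmorphM /= rmorph_nat.
  - by rewrite mulr_gt0 ?pi_gt0.
  - exact: cst_continuous.
  - move=> t; have := cderiveM (cderive_real (is_derive_id t 1)) (cderive_cst 'i t).
    by rewrite mulr0 addr0 mul1r.
- by move=> s t; apply: cvgCM; [exact: cwt|exact: continuous_dcirc].
- move=> p; apply: cvgCM.
    apply: cvgCM; last exact: cvg_cst.
    by apply: (@continuous2_fst (fun s => (cos s)%:C)); apply: continuousC_real; exact: continuous_cos.
  apply: cvgCM; last by apply: continuous2_snd; exact: continuous_dcirc.
  by apply: cvgCM; exact: cw.
- move=> s t.
  have d1 := cderiveD (cderive_cst (circ t) s) (cderiveZ (-1) (db s)).
  have e1 : (fun s => circ t + -1 * b s) = (fun s => circ t - b s).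
    by apply/funext => r; rewrite mulN1r.
  rewrite e1 add0r in d1.
  have := cderiveM (@cderive_comp _ (fun y => y^-1) _ _ _ _ (is_deriveC_V (nz s t)) d1)
                   (cderive_cst (dcirc t) s).
  rewrite mulr0 addr0 /= -exprVn.
  by rewrite (_ : _ * dcirc t = F' s t) // /F' mulN1r mulrNN; ring.
- move=> s; rewrite /F'.
  rewrite cintegralZ; last first.
    move=> t; apply: cvgCM; last exact: continuous_dcirc.
    by apply: cvgCM; exact: cwt.
  rewrite -(circle_integralE (fun l => (l - b s)^-1 ^+ 2)).
  have e0 : circle_integral (c, rho) (fun l => (l - b s)^-1 ^+ 2) = 0.
    apply: (@circle_integral_primitive (fun l => -1 * (l - b s)^-1 ^+ 1)).
      move=> t; have tb : circ t != b s by exact: circ_neq.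
      have := is_deriveCM (is_deriveC_cst (-1) (circ t)) (is_derive_invsub 1 tb).
      by rewrite mul0r add0r mulrA mulrNN !mul1r.
    by move=> t; apply: cvgCM; exact: cwt.
  by rewrite e0 mulr0.
Qed.

End circle.

Section cauchy.
Context {R : realType}.
Local Notation C := R[i].
Variables (c : C) (rho : R).
Hypothesis rho_gt0 : 0 < rho.
Local Notation D := [set x : C | cabs (x - c) <= rho].
Local Notation circ := (circ c rho).
Local Notation dcirc := (dcirc rho).

Lemma circ_disc t : D (circ t).
Proof. by rewrite /= cabs_circ. Qed.

(** Contracting the circle towards a leaves the integral of f(l) / (l - a)
unchanged: the derivative in the contraction ratio is again the integral of an
exact form.  The ratio is sin^2 so that the parameter ranges over the whole
line while the contracted circles stay in the disc. *)
Lemma cauchy_formula (f f' : C -> C) (a : C) :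
  (forall x, D x -> is_derive x 1 f (f' x)) ->
  (forall x, D x -> {for x, continuous f'}) ->
  cabs (a - c) < rho ->
  circle_integral (c, rho) (fun l => f l * (l - a)^-1) = 2 * pi%:C * 'i * f a.
Proof.
move=> df cf' aD.
have cf x : D x -> {for x, continuous f} by move=> /df; exact: is_deriveC_continuous.
have nz t : circ t - a != 0 by rewrite subr_eq0 circ_neq.
pose s2 (s : R) := sin s ^+ 2.
have s2_01 s : 0 <= s2 s <= 1.
  by rewrite sqr_ge0 /= -(cos2Dsin2 s) lerDr sqr_ge0.
pose w s t := a + (s2 s)%:C * (circ t - a).
have wD s t : D (w s t).
  have /andP[s0 s1] := s2_01 s.
  rewrite /= (_ : w s t - c = (1 - s2 s)%:C * (a - c) + (s2 s)%:C * (circ t - c)); last first.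
    by rewrite /w rmorphB rmorph1; ring.
  rewrite (le_trans (cabsD _ _)) // !cabsM !cabs_real cabs_circ //.
  rewrite ger0_norm ?subr_ge0 // ger0_norm //.
  have : (1 - s2 s) * cabs (a - c) <= (1 - s2 s) * rho.
    by apply: ler_wpM2l; [rewrite subr_ge0|exact: ltW].
  lra.
pose F s t := f (w s t) * ((circ t - a)^-1 * dcirc t).
pose F' s t := (2 * sin s * cos s)%:C * (f' (w s t) * dcirc t).
have ds2 s : cderive (fun r => (s2 r)%:C : C) s (2 * sin s * cos s)%:C.
  apply: cderive_real; rewrite /s2.
  have := is_deriveX 2 (is_derive_sin s).
  by rewrite /= expr1 /GRing.scale /= [2%:R * _]mulrC [sin s * 2]mulrC.
have dws t s : cderive (w ^~ t) s ((2 * sin s * cos s)%:C * (circ t - a)).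
  have := cderiveD (cderive_cst a s) (cderiveM (ds2 s) (cderive_cst (circ t - a) s)).
  by rewrite add0r mulr0 addr0.
have dwt s t : cderive (w s) t ((s2 s)%:C * dcirc t).
  have h1 := cderiveD (cderive_circ c rho t) (cderive_cst (- a) t).
  have := cderiveD (cderive_cst a t) (cderiveZ (s2 s)%:C h1).
  by rewrite add0r addr0.
have cwt s : continuous (w s) by move=> t; exact: cderive_continuous (dwt s t).
have cw : continuous (fun p : R * R => w p.1 p.2).
  move=> p; apply: cvgCD; first exact: cvg_cst.
  apply: cvgCM.
    apply: (@continuous2_fst _ (fun s => (s2 s)%:C)) => s.
    exact: cderive_continuous (ds2 s).
  apply: cvgCD; last exact: cvg_cst.
  by apply: continuous2_snd; exact: continuous_circ.
have cV : continuous (fun t => (circ t - a)^-1).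
  move=> t; apply: cvgCV; first exact: nz.
  by apply: cvgCD; [exact: continuous_circ|exact: cvg_cst].
have E1 : circle_integral (c, rho) (fun l => f l * (l - a)^-1) =
    cintegral 0 (2 * pi) (F (pi / 2)).
  rewrite circle_integralE; apply: eq_cintegral => t.
  rewrite /F /w /s2 sin_pihalf expr1n mul1r -mulrA; congr (f _ * _).
  by rewrite addrC subrK.
rewrite E1 (@cintegral_param_cst _ F F' 0 (2 * pi) (pi / 2) 0).
- have -> : F 0 = fun t => f a * ((circ t - a)^-1 * dcirc t).
    by apply/funext => t; rewrite /F /w /s2 sin0 expr0n mul0r addr0.
  rewrite cintegralZ; last first.
    by move=> t; apply: cvgCM; [exact: cV|exact: continuous_dcirc].
  by rewrite -(circle_integralE _ _ (fun l => (l - a)^-1)) circle_integral_pole // mulrC.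
- move=> s t; apply: cvgCM.
    exact: (cvg_comp _ _ (cwt s t) (cf _ (wD s t))).
  by apply: cvgCM; [exact: cV|exact: continuous_dcirc].
- move=> p; apply: cvgCM.
    apply: (@continuous2_fst _ (fun s => (2 * sin s * cos s)%:C)).
    apply: continuousC_real => s; apply: cvgM; last exact: continuous_cos.
    by apply: cvgM; [exact: cvg_cst|exact: continuous_sin].
  apply: cvgCM; first exact: (cvg_comp _ _ (cw p) (cf' _ (wD p.1 p.2))).
  by apply: continuous2_snd; exact: continuous_dcirc.
- move=> s t.
  have := cderiveM (@cderive_comp _ f (w ^~ t) s _ _ (df _ (wD s t)) (dws t s))
                   (cderive_cst ((circ t - a)^-1 * dcirc t) s).
  rewrite mulr0 addr0 (_ : _ * (_ * dcirc t) = F' s t) //.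
  rewrite /F' mulrACA mulrA; have := nz t; move: (circ t - a) => y y0.
  by field.
- move=> s; rewrite /F' cintegralZ; last first.
    move=> t; apply: cvgCM; last exact: continuous_dcirc.
    exact: (cvg_comp _ _ (cwt s t) (cf' _ (wD s t))).
  have [s0|s0] := eqVneq (sin s) 0; first by rewrite s0 mulr0 mul0r mul0r.
  have ss0 : (s2 s)%:C != 0 :> C.
    by apply/eqP => -[] /eqP; rewrite sqrf_eq0 (negbTE s0).
  have e0 : cintegral 0 (2 * pi) (fun t => (s2 s)%:C * (f' (w s t) * dcirc t)) = 0.
    rewrite (@cintegral_FTC _ (f \o w s)).
    - by rewrite /= /w circ_2pi subrr.
    - by rewrite mulr_gt0 ?pi_gt0.
    - move=> t; apply: cvgCM; first exact: cvg_cst.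
      apply: cvgCM; last exact: continuous_dcirc.
      exact: (cvg_comp _ _ (cwt s t) (cf' _ (wD s t))).
    - move=> t; have := cderive_comp (df _ (wD s t)) (dwt s t).
      by rewrite mulrCA.
  move: e0; rewrite cintegralZ; last first.
    move=> t; apply: cvgCM; last exact: continuous_dcirc.
    exact: (cvg_comp _ _ (cwt s t) (cf' _ (wD s t))).
  by move=> /eqP; rewrite mulf_eq0 (negbTE ss0) /= => /eqP ->; rewrite mulr0.
Qed.

Section tower.
Variable G : nat -> C -> C.
Hypothesis dG : forall k x, D x -> is_derive x 1 (G k) (G k.+1 x).

Lemma tower_continuous k x : D x -> {for x, continuous (G k)}.
Proof. by move=> /(dG k); exact: is_deriveC_continuous. Qed.

(** Integration by parts along the closed circle, which lowers the order of the
pole. *)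
Lemma circle_integral_parts (a : C) (j k : nat) : (forall t, circ t != a) ->
  k.+1%:R * circle_integral (c, rho) (fun l => G j l * (l - a)^-1 ^+ k.+2) =
  circle_integral (c, rho) (fun l => G j.+1 l * (l - a)^-1 ^+ k.+1).
Proof.
move=> na.
have cG i : continuous (fun t => G i (circ t)).
  move=> t; apply: (cvg_comp _ _ (@continuous_circ _ c rho t)).
  by apply: tower_continuous; exact: circ_disc.
have cV i : continuous (fun t => (circ t - a)^-1 ^+ i).
  elim: i => [|i ih]; first exact: cst_continuous.
  have -> : (fun t => (circ t - a)^-1 ^+ i.+1) = (fun t => (circ t - a)^-1 * (circ t - a)^-1 ^+ i).
    by apply/funext => t; rewrite exprS.
  move=> t; apply: cvgCM; last exact: ih.
  apply: cvgCV; first by rewrite subr_eq0 na.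
  by apply: cvgCD; [exact: continuous_circ|exact: cvg_cst].
have cGV i m : continuous (fun t => G i (circ t) * (circ t - a)^-1 ^+ m).
  by move=> t; apply: cvgCM; [exact: cG|exact: cV].
have cGVd i m : continuous (fun t => G i (circ t) * (circ t - a)^-1 ^+ m * dcirc t).
  by move=> t; apply: cvgCM; [exact: cGV|exact: continuous_dcirc].
apply/eqP; rewrite -subr_eq0 -oppr_eq0 opprB -mulNr !circle_integralE.
rewrite -cintegralZ // -cintegralD //; last first.
  by move=> t; apply: cvgCM; [exact: cvg_cst|exact: cGVd].
pose h l := G j.+1 l * (l - a)^-1 ^+ k.+1 + G j l * (- k.+1%:R * (l - a)^-1 ^+ k.+2).
rewrite (@eq_cintegral _ _ _ _ (fun t => h (circ t) * dcirc t)); last first.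
  by move=> t; rewrite /h; ring.
apply/eqP; apply: (@circle_integral_primitive _ _ _ (fun l => G j l * (l - a)^-1 ^+ k.+1)).
  move=> t; apply: is_deriveCM; first by apply: dG; exact: circ_disc.
  exact: is_derive_invsub.
move=> t; apply: cvgCD; first exact: cGV.
apply: cvgCM; first exact: cG.
by apply: cvgCM; [exact: cvg_cst|exact: cV].
Qed.

Lemma cauchy_formula_deriv (a : C) (j k : nat) : cabs (a - c) < rho ->
  circle_integral (c, rho) (fun l => G j l * (l - a)^-1 ^+ k.+1) =
  2 * pi%:C * 'i * (G (j + k) a / k`!%:R).
Proof.
move=> aD; elim: k j => [|k ih] j.
  rewrite addn0 fact0 divr1.
  by rewrite -(@cauchy_formula (G j) (G j.+1) a (@dG j) (@tower_continuous j.+1) aD).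
have /(circle_integral_parts j k) : forall t, circ t != a by move=> t; exact: circ_neq.
have k0 : k.+1%:R != 0 :> C by rewrite pnatr_eq0.
rewrite ih addSnnS => /(canRL (mulKf k0)) ->.
rewrite factS natrM; have f0 : k`!%:R != 0 :> C by rewrite pnatr_eq0 -lt0n fact_gt0.
move: (k.+1%:R : C) (k`!%:R : C) k0 f0 => x y x0 y0.
by field; rewrite x0 y0.
Qed.

Lemma cauchy_outside (a : C) (j k : nat) : rho < cabs (a - c) ->
  circle_integral (c, rho) (fun l => G j l * (l - a)^-1 ^+ k.+1) = 0.
Proof.
move=> aD.
have na x : D x -> x != a.
  by move=> /= xD; apply/eqP => xa; rewrite -xa ltNge xD in aD.
elim: k j => [|k ih] j.
  (* A holomorphic function of the disc integrates to zero: multiply it by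
     l - c and apply the formula at the centre. *)
  pose f l := G j l * (l - a)^-1 ^+ 1 * (l - c).
  pose f' l := (G j.+1 l * (l - a)^-1 ^+ 1 + G j l * (- 1%:R * (l - a)^-1 ^+ 2)) * (l - c) +
    G j l * (l - a)^-1 ^+ 1 * 1.
  have dVa m x : D x -> is_derive x 1 (fun y => (y - a)^-1 ^+ m) (- m%:R * (x - a)^-1 ^+ m.+1).
    by move=> xD; apply: is_derive_invsub; exact: na.
  have df x : D x -> is_derive x 1 f (f' x).
    move=> xD; apply: is_deriveCM; last exact: is_deriveC_subr.
    by apply: is_deriveCM; [exact: dG|exact: dVa].
  have cf' x : D x -> {for x, continuous f'}.
    move=> xD.
    have cVa m := is_deriveC_continuous (dVa m x xD).
    have c1 (y : C) := is_deriveC_continuous (is_deriveC_cst y x).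
    have cc := is_deriveC_continuous (is_deriveC_subr c x).
    have T i : {for x, continuous (G i)} by exact: tower_continuous.
    have h1 := contCD (contCM (T j.+1) (cVa 1%N)) (contCM (T j) (contCM (c1 (- 1%:R)) (cVa 2%N))).
    exact: (contCD (contCM h1 cc) (contCM (contCM (T j) (cVa 1%N)) (c1 1))).
  have c0 : cabs (c - c) < rho by rewrite subrr /cabs normr0.
  have := cauchy_formula df cf' c0.
  rewrite /f subrr mulr0 mulr0 => <-.
  rewrite !circle_integralE; apply: eq_cintegral => t.
  by rewrite -[_ * (_ - c) * _]mulrA mulfV ?mulr1 // subr_eq0 circ_neq.
have /(circle_integral_parts j k) : forall t, circ t != a.
  by move=> t; apply: na; exact: circ_disc.
by rewrite ih => /eqP; rewrite mulf_eq0 pnatr_eq0 /= => /eqP.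
Qed.

End tower.
End cauchy.

(** * Hermite interpolation by polynomials *)

Section hermite.
Variable K : numFieldType.
Implicit Types (s : seq K) (p q : {poly K}) (J : K -> nat -> K).

Definition nodal s : {poly K} := \prod_(x <- s) ('X - x%:P).

Lemma nodal_cons a s : nodal (a :: s) = ('X - a%:P) * nodal s.
Proof. by rewrite /nodal big_cons. Qed.

Lemma nodal_cat s t : nodal (s ++ t) = nodal s * nodal t.
Proof. by rewrite /nodal big_cat. Qed.

Lemma monic_nodal s : nodal s \is monic.
Proof. exact: monic_prod_XsubC. Qed.

Lemma size_nodal s : size (nodal s) = (size s).+1.
Proof. exact: size_prod_XsubC. Qed.

Lemma derivn_XsubCM q a j :
  (('X - a%:P) * q)^`(j.+1) = ('X - a%:P) * q^`(j.+1) + q^`(j) *+ j.+1.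
Proof.
elim: j => [|j ih]; first by rewrite !derivn1 derivn0 derivM derivXsubC mul1r addrC.
rewrite derivnS ih derivD derivM derivXsubC mul1r derivMn -!derivnS.
by rewrite addrAC addrC -mulrS addrC.
Qed.

(** Agreement of derivatives up to the multiplicity of each point in s: the
condition of Hermite interpolation on the list s. *)
Definition jets_eq s (J J' : K -> nat -> K) :=
  forall x j, (j < count_mem x s)%N -> J x j = J' x j.

Definition pjet p : K -> nat -> K := fun x j => p^`(j).[x].

(** Induction on the nodes: if p = ('X - a) q, the derivative of order j of q at a
is that of order j + 1 of p divided by j + 1, so characteristic zero is used. *)
Lemma nodal_dvdP s p : jets_eq s (pjet p) (fun _ _ => 0) -> nodal s %| p.
Proof.
elim: s p => [|a s ih] p h; first by rewrite /nodal big_nil dvd1p.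
have pa : root p a by rewrite /root; apply/eqP; apply: (h a 0%N); rewrite /= eqxx.
have /dvdpP[q pq] : ('X - a%:P) %| p by rewrite dvdp_XsubCl.
rewrite mulrC in pq; rewrite pq nodal_cons dvdp_mul2l ?polyXsubC_eq0 //; apply: ih.
move=> x j; have [->|xa] := eqVneq x a => jc.
  have := h a j.+1; rewrite /pjet pq derivn_XsubCM !hornerE subrr mul0r add0r.
  rewrite /= eqxx add1n ltnS => /(_ jc) /eqP.
  by rewrite hornerMn mulrn_eq0 /= => /eqP.
elim: j jc => [|j jh] jc.
  have := h x 0%N; rewrite /pjet pq !derivn0 /= eq_sym (negbTE xa) add0n => /(_ jc) /eqP.
  by rewrite !hornerE mulf_eq0 subr_eq0 (negbTE xa) /= => /eqP.
have := h x j.+1; rewrite /pjet pq derivn_XsubCM !hornerE hornerMn.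
move: (jh (ltnW jc)); rewrite /pjet => ->; rewrite mul0rn addr0.
rewrite /= eq_sym (negbTE xa) add0n => /(_ jc) /eqP.
by rewrite mulf_eq0 subr_eq0 (negbTE xa) /= => /eqP.
Qed.

(** The i-th entry of the list s stands for the condition on the derivative of
order [ordr s i] at [node s i]; repeated entries have successive orders. *)
Definition node s i := nth 0 s i.
Definition ordr s i := count_mem (node s i) (take i s).

Lemma node_ordr_exists s x j : (j < count_mem x s)%N ->
  exists2 i, (i < size s)%N & node s i = x /\ ordr s i = j.
Proof.
elim: s j => [|y s ih] j //=.
have [->|yx] := eqVneq y x.
  case: j => [|j]; first by move=> _; exists 0%N => //; rewrite /ordr /node take0.
  rewrite add1n ltnS => /ih[i si [xi oi]]; exists i.+1 => //; split => //.
  by rewrite /ordr /node /= -/(node s i) xi eqxx -oi /ordr xi.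
rewrite add0n => /ih[i si [xi oi]]; exists i.+1 => //; split => //.
by rewrite /ordr /node /= -/(node s i) xi (negbTE yx) -oi /ordr xi.
Qed.

(** The matrix of the interpolation conditions on the monomials of degree less
than size s.  It is invertible because a polynomial of that size that satisfies
the homogeneous conditions is a multiple of the nodal polynomial. *)
Definition jet_matrix s : 'M[K]_(size s) :=
  \matrix_(k, i) pjet 'X^k (node s i) (ordr s i).

Lemma jet_matrixE s (u : 'rV[K]_(size s)) i :
  (u *m jet_matrix s) 0 i = pjet (rVpoly u) (node s i) (ordr s i).
Proof.
rewrite mxE /pjet -[rVpoly u in RHS]coefK poly_def.
rewrite (_ : \sum_(k < _) _ = \sum_(k < size s) u 0 k *: 'X^k); last first.
  rewrite -poly_def coefK; apply/polyP => k; rewrite coef_rVpoly coef_sumMXn.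
  case: insubP => [k' _ <-|].
    rewrite (bigD1 k') //= big1 ?addr0 // => l /andP[/eqP lk /eqP []].
    exact: val_inj.
  move=> kn; rewrite big1 // => l /eqP lk.
  by rewrite -lk ltn_ord in kn.
rewrite raddf_sum horner_sum; apply: eq_bigr => k _.
by rewrite mxE /= derivnZ hornerZ.
Qed.

Lemma jet_matrix_unit s : jet_matrix s \in unitmx.
Proof.
rewrite -row_free_unit; apply: inj_row_free => u uM.
have /nodal_dvdP nd : jets_eq s (pjet (rVpoly u)) (fun _ _ => 0).
  move=> x j /node_ordr_exists[i si [<- <-]].
  by rewrite -(jet_matrixE u (Ordinal si)) uM mxE.
apply: (can_inj rVpolyK); rewrite linear0; apply/eqP; apply/negPn/negP => u0.
by move: (dvdp_leq u0 nd); rewrite size_nodal leqNgt ltnS size_poly.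
Qed.

Definition hbasis s (i : 'I_(size s)) : {poly K} := rVpoly (row i (invmx (jet_matrix s))).

Lemma hbasisE s (i k : 'I_(size s)) :
  pjet (hbasis i) (node s k) (ordr s k) = (i == k)%:R.
Proof.
by rewrite -jet_matrixE -row_mul mulVmx ?jet_matrix_unit // !mxE.
Qed.

Definition herm s J : {poly K} := \sum_(i < size s) J (node s i) (ordr s i) *: hbasis i.

Lemma pjetB p q x j : pjet (p - q) x j = pjet p x j - pjet q x j.
Proof. by rewrite /pjet derivnB hornerD hornerN. Qed.

Lemma herm_jets s J : jets_eq s (pjet (herm s J)) J.
Proof.
move=> x j /node_ordr_exists[i si [<- <-]].
rewrite /pjet /herm raddf_sum horner_sum (bigD1 (Ordinal si)) //= big1 => [|k ki].
  by rewrite /= derivnZ hornerZ -/(pjet _ _ _) (hbasisE _ (Ordinal si)) eqxx mulr1 addr0.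
by rewrite /= derivnZ hornerZ -/(pjet _ _ _) (hbasisE _ (Ordinal si)) (negbTE ki) mulr0.
Qed.

Lemma herm_unique s J p : jets_eq s (pjet p) J -> nodal s %| herm s J - p.
Proof.
move=> h; apply: nodal_dvdP => x j jc.
by rewrite pjetB herm_jets // h // subrr.
Qed.

End hermite.

Section leibniz.
Variable K : comNzRingType.

(** The n-th derivative of a product, from the derivatives of the factors. *)
Definition leib (a b : nat -> K) (n : nat) : K :=
  \sum_(i < n.+1) (a i * b (n - i)%N) *+ 'C(n, i).

(** Pascal's rule, in the form in which the derivative of [leib] produces it. *)
Lemma leibS (a b : nat -> K) n :
  \sum_(i < n.+1) (a i.+1 * b (n - i)%N + a i * b (n - i).+1) *+ 'C(n, i) = leib a b n.+1.
Proof.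
under eq_bigr do rewrite mulrnDl.
rewrite big_split /= /leib addrC big_ord_recl [RHS]big_ord_recl /= !bin0 !subn0 -addrA.
congr (_ + _).
under [RHS]eq_bigr => i _ do rewrite binS mulrnDr subSS.
rewrite [RHS]big_split /=; congr (_ + _).
rewrite [RHS]big_ord_recr /= bin_small // mulr0n addr0.
apply: eq_bigr => i _; rewrite /bump /= add1n.
by rewrite -subSn ?ltn_ord // subSS.
Qed.

End leibniz.

Lemma pjetM (K : numFieldType) (p q : {poly K}) x j :
  pjet (p * q) x j = leib (pjet p x) (pjet q x) j.
Proof.
suff h n : (p * q)^`(n) = leib (fun k => p^`(k)) (fun k => q^`(k)) n.
  rewrite /pjet h /leib horner_sum; apply: eq_bigr => i _.
  by rewrite hornerMn hornerM.
elim: n => [|n ih]; first by rewrite /leib big_ord_recl big_ord0 addr0.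
rewrite derivnS ih -leibS /leib raddf_sum; apply: eq_bigr => i _.
by rewrite /= derivMn derivM -!derivnS.
Qed.

Lemma hermZ (K : numFieldType) (s : seq K) (c : K) J :
  herm s (fun x j => c * J x j) = c *: herm s J.
Proof.
rewrite /herm scaler_sumr; apply: eq_bigr => i _; by rewrite scalerA.
Qed.

Lemma leib_eq (K : comNzRingType) (a b b' : nat -> K) n :
  (forall j, (j <= n)%N -> b j = b' j) -> leib a b n = leib a b' n.
Proof. by move=> h; apply: eq_bigr => i _; rewrite h // leq_subr. Qed.

Section affine.
Variable K : numFieldType.
Variables (a q : K).
Local Notation aff := (fun x => a + q * x).
Local Notation paff := (a%:P + q *: 'X).

Lemma horner_paff x : (a%:P + q *: 'X).[x] = a + q * x.
Proof. by rewrite !hornerE. Qed.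

Lemma pjet_comp_affine (p : {poly K}) x j :
  pjet (p \Po paff) x j = q ^+ j * pjet p (aff x) j.
Proof.
have dq : paff^`() = q%:P.
  by rewrite derivD derivC add0r derivZ derivX -mul_polyC mulr1.
have h : (p \Po paff)^`(j) = q ^+ j *: (p^`(j) \Po paff).
  elim: j => [|j ih]; first by rewrite !derivn0 expr0 scale1r.
  rewrite derivnS ih derivZ deriv_comp dq -derivnS mulrC mul_polyC scalerA.
  by rewrite -exprSr.
by rewrite /pjet h hornerZ horner_comp horner_paff.
Qed.

Lemma nodal_comp_affine (s : seq K) :
  nodal (map aff s) \Po paff = q ^+ size s *: nodal s.
Proof.
elim: s => [|x s ih] /=; first by rewrite /nodal !big_nil comp_polyC scale1r.
rewrite !nodal_cons comp_polyM ih comp_polyB comp_polyX comp_polyC.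
have -> : paff - (a + q * x)%:P = q *: ('X - x%:P).
  by rewrite polyCD polyCM scalerBr -!mul_polyC; ring.
by rewrite -scalerAl -scalerAr exprS scalerA.
Qed.

Lemma horner_mx_affine n (A : 'M[K]_n.+1) (p : {poly K}) :
  horner_mx (a%:M + q *: A) p = horner_mx A (p \Po paff).
Proof.
have e : horner_mx A paff = a%:M + q *: A.
  by rewrite rmorphD /= horner_mx_C linearZ /= horner_mx_X.
elim/poly_ind: p => [|p c ih]; first by rewrite comp_poly0 !rmorph0.
rewrite comp_poly_MXaddC.
have hD (B : 'M[K]_n.+1) (p1 p2 : {poly K}) :
    horner_mx B (p1 * p2 + c%:P) = horner_mx B p1 * horner_mx B p2 + c%:M.
  by rewrite rmorphD rmorphM /= horner_mx_C.
by rewrite !hD horner_mx_X e ih.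
Qed.

(** Precomposition with an affine map sends interpolants to interpolants, even
when the map is not injective: it can only increase multiplicities. *)
Lemma herm_comp_affine (s : seq K) J :
  nodal s %| herm s (fun x j => q ^+ j * J (aff x) j) - (herm (map aff s) J \Po paff).
Proof.
apply: herm_unique => x j jc; rewrite pjet_comp_affine herm_jets //.
apply: leq_trans jc _; rewrite count_map; apply: sub_count => y /= /eqP ->.
by rewrite eqxx.
Qed.

End affine.

(** * Evaluation of functions of a matrix *)

Lemma pairwise_mem (T : eqType) (r : rel T) (s : seq T) : symmetric r ->
  pairwise r s -> {in s &, forall x y, x != y -> r x y}.
Proof.
move=> sr; elim: s => [|z s ih] //= /andP[/allP zs ps] x y.
rewrite !inE => /predU1P[->|xs] /predU1P[->|ys]; rewrite ?eqxx //.
- by move=> _; exact: zs.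
- by move=> _; rewrite sr; exact: zs.
- exact: ih.
Qed.

Section matfun.
Context {R : realType}.
Local Notation C := R[i].

(** A function together with all its derivatives.  Giving the derivatives
explicitly avoids iterated derivatives of composed functions. *)
Definition tower (U : set C) (G : nat -> C -> C) :=
  forall k x, U x -> is_derive x 1 (G k) (G k.+1 x).

Lemma open_cabs (U : set C) x : open U -> U x ->
  exists2 e : R, 0 < e & forall y, cabs (y - x) < e -> U y.
Proof.
move=> oU Ux; have /nbhs_ballP[e e0 he] : nbhs x U by exact: open_nbhs_nbhs.
have [ee e1] := gt0_complex e0.
exists (complex.Re e) => // y yx; apply: he.
by rewrite -ball_normE /= ee -cabsE ltcR -cabsN opprB.
Qed.

Lemma closed_ball_cabs (x y : C) (r : R) :
  closed_ball_ Num.norm x r%:C y = (cabs (y - x) <= r) :> Prop.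
Proof. by rewrite /closed_ball_ /= -cabsE lecR -cabsN opprB. Qed.

Lemma common_radius (T : eqType) (s : seq T) (P : T -> R -> Prop) :
  (forall x, x \in s -> exists2 e : R, 0 < e & forall r, 0 < r -> r < e -> P x r) ->
  exists2 e : R, 0 < e & forall r, 0 < r -> r < e -> forall x, x \in s -> P x r.
Proof.
elim: s => [|a s ih] h; first by exists 1.
have [|e e0 he] := ih; first by move=> x xs; apply: h; rewrite inE xs orbT.
have [|d d0 hd] := h a; first by rewrite inE eqxx.
exists (Num.min e d); first by rewrite lt_min e0.
move=> r r0; rewrite lt_min => /andP[re rd] x.
by rewrite inE => /predU1P[->|xs]; [exact: hd|exact: he].
Qed.

(** Circles of one small radius around the distinct points of rs: smaller than
half the distance of any two of them, and than their distance to the complement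
of U. *)
Lemma contour_exists (U : set C) (rs : seq C) : open U -> [set` rs] `<=` U ->
  exists G, encloses U [set` rs] G.
Proof.
move=> oU rsU.
have [e1 e10 h1] : exists2 e : R, 0 < e & forall r, 0 < r -> r < e ->
    forall x, x \in rs -> forall y, cabs (y - x) <= r -> U y.
  apply: common_radius => x xs; have [e e0 he] := open_cabs oU (rsU _ xs).
  by exists e => // r r0 re y yx; apply: he; exact: le_lt_trans re.
have [e2 e20 h2] : exists2 e : R, 0 < e & forall r, 0 < r -> r < e ->
    forall p, p \in [seq (x, y) | x <- rs, y <- rs] -> p.1 != p.2 -> 2 * r < cabs (p.1 - p.2).
  apply: common_radius => -[x y] _ /=.
  have [->|xy] := eqVneq x y; first by exists 1.
  exists (cabs (x - y) / 2) => [|r r0]; last by lra.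
  rewrite divr_gt0 // lt_neqAle cabs_ge0 andbT eq_sym; apply: contra xy => /eqP m0.
  by rewrite -subr_eq0 -normr_eq0 -cabsE m0.
pose r := Num.min e1 e2 / 2.
have m0 : 0 < Num.min e1 e2 by rewrite lt_min e10.
have r0 : 0 < r by rewrite divr_gt0.
have rm : r < Num.min e1 e2 by rewrite /r; lra.
move: rm; rewrite lt_min => /andP[re1 re2].
exists [seq (x, r) | x <- undup rs]; split.
- by rewrite all_map; apply/allP => x _ /=.
- rewrite pairwise_map.
  have := undup_uniq rs; rewrite uniq_pairwise; apply: (@sub_in_pairwise _ [in rs]); last first.
    by apply/allP => x; rewrite mem_undup.
  move=> x y xs ys xy /=.
  apply/disj_setPS => w []; rewrite !closed_ball_cabs => wx wy.
  have := h2 _ r0 re2 (x, y); rewrite allpairs_f // => /(_ isT xy) /=.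
  have := cabsD (x - w) (w - y); rewrite addrA subrK -(cabsN (x - w)) opprB.
  lra.
- move=> D /mapP[x]; rewrite mem_undup => xs -> /= w.
  by rewrite closed_ball_cabs; exact: h1.
- move=> x xs; exists (x, r); first by apply/mapP; exists x => //; rewrite mem_undup.
  by rewrite -ball_normE /= subrr normr0 ltcR.
Qed.

(** Disjointness of the closed discs puts each point inside exactly one circle and
strictly outside the others, so that its winding number can be read off. *)
Lemma encloses_sep (U S : set C) G : encloses U S G -> uniq G /\
  forall s, S s -> exists2 D, D \in G & cabs (s - D.1) < D.2 /\
    forall E, E \in G -> E != D -> E.2 < cabs (s - E.1).
Proof.
move=> [/allP G0 pG _ SG]; split.
  elim: G G0 pG {SG} => [|D G ih] //= G0 /andP[/allP DG pG].
  rewrite ih // ?andbT; last by move=> E EG; apply: G0; rewrite inE EG orbT.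
  apply/negP => /DG /disj_setPS /(_ D.1) []; split;
    by rewrite closed_ball_cabs subrr /cabs normr0 ltW // G0 ?inE ?eqxx.
move=> s Ss; have [D DG] := SG _ Ss; rewrite -ball_normE /= -cabsE ltcR => sD.
exists D => //; split; first by rewrite -cabsN opprB.
move=> E EG ED; have : disj_set (closed_ball_ Num.norm E.1 E.2%:C) (closed_ball_ Num.norm D.1 D.2%:C).
  by apply: (pairwise_mem _ pG) => // A B; rewrite /disj_set setIC.
move=> /disj_setPS /(_ s) h; rewrite ltNge; apply/negP => sE; apply: h.
by split; rewrite closed_ball_cabs // -cabsN opprB ltW.
Qed.

Section matrix_function.
Variables (n : nat) (B : 'M[C]_n.+1) (rs : seq C).
Hypothesis rs0 : horner_mx B (nodal rs) = 0.

Lemma dvdp_horner_mx (p q : {poly C}) : nodal rs %| p - q -> horner_mx B p = horner_mx B q.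
Proof.
move=> /dvdpP[k pq]; apply/eqP; rewrite -subr_eq0 -rmorphB pq rmorphM /= rs0 mulr0.
by [].
Qed.

Lemma spectrum_sub : spectrum B `<=` [set` rs].
Proof.
move=> a; rewrite /spectrum /= eigenvalue_root_min => ra.
have /dvdpP[k e] := mxminpoly_min rs0.
have : root (nodal rs) a by rewrite e rootM ra orbT.
by rewrite /nodal root_prod_XsubC.
Qed.

(** Partial fractions of the resolvent.  The interpolant H on rs of
w |-> 1 / (l - w) satisfies (l - 'X) H = 1 modulo the nodal polynomial, which
vanishes at B. *)
Lemma resolvent_hbasis l : l \notin rs ->
  invmx (l%:M - B) =
  \sum_(k < size rs) ((ordr rs k)`!%:R * (l - node rs k)^-1 ^+ (ordr rs k).+1)
     *: horner_mx B (hbasis k).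
Proof.
move=> lrs; pose J (x : C) j := j`!%:R * (l - x)^-1 ^+ j.+1.
have /dvdp_horner_mx : nodal rs %| (l%:P - 'X) * herm rs J - 1.
  rewrite -[l%:P - 'X]opprB mulNr; apply: nodal_dvdP => x j jc; rewrite pjetB.
  have xrs : x \in rs by rewrite -has_pred1 has_count (leq_ltn_trans _ jc).
  have lx : l - x != 0 by rewrite subr_eq0; apply: contraNneq lrs => ->.
  have -> : pjet (- (('X - l%:P) * herm rs J)) x j = - pjet (('X - l%:P) * herm rs J) x j.
    by rewrite /pjet derivnN hornerN.
  case: j jc => [|j] jc.
    rewrite /pjet !derivn0 !hornerE -/(pjet (herm rs J) x 0) herm_jets // /J fact0 mul1r.
    by rewrite expr1 -mulNr opprB mulfV // subrr.
  rewrite {2}/pjet derivnC /= hornerE subr0 /pjet derivn_XsubCM !hornerE hornerMn.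
  rewrite -/(pjet (herm rs J) x j.+1) -/(pjet (herm rs J) x j) !herm_jets // ?(ltnW jc) //.
  rewrite /J factS natrM -[X in _ + X]mulr_natr !exprS.
  move: (j.+1%:R) (j`!%:R) ((l - x)^-1 ^+ j) => a b w.
  by field.
rewrite rmorphM rmorphB /= horner_mx_C horner_mx_X rmorph1 => e.
have [lu _] := mulmx1_unit e.
rewrite -[LHS]mulmx1 -[1%:M]e mulKmx // /herm raddf_sum; apply: eq_bigr => k _.
by rewrite /= linearZ.
Qed.

Hypothesis rsS : [set` rs] `<=` spectrum B.

(** The integrals of G 0 against the partial fractions of the resolvent are, by
Cauchy's formulas, the interpolation data of G. *)
Lemma matfun_herm (U : set C) (g : C -> C) (G : nat -> C -> C) :
  open U -> [set` rs] `<=` U -> tower U G -> (forall x, U x -> g x = G 0%N x) ->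
  matfun U g B = horner_mx B (herm rs (fun x j => G j x)).
Proof.
move=> oU rsU tG gG; rewrite /matfun.
have SE : spectrum B = [set` rs] by apply/seteqP; split => //; exact: spectrum_sub.
set Gam := xget _ _; have encl : encloses U [set` rs] Gam.
  rewrite /Gam SE; apply: xgetPex; exact: contour_exists.
have [uG sep] := encloses_sep encl.
have [/allP G0 _ GU _] := encl.
have DU D x : D \in Gam -> cabs (x - D.1) <= D.2 -> U x.
  by move=> DG h; apply: (GU D DG); rewrite closed_ball_cabs.
(* Each x in rs is strictly inside one circle and strictly outside the others. *)
have off D x t : D \in Gam -> x \in rs -> circ D.1 D.2 t != x.
  move=> DG xs; have [E EG [xE hE]] := sep _ xs.
  have [DE|DE] := eqVneq D E; first by rewrite DE circ_neq // G0.
  apply/eqP => e; have := hE _ DG DE; rewrite -e cabs_circ ?G0 // ltxx.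
  by [].
apply/matrixP => i j; rewrite !mxE.
set c := fun k : 'I_(size rs) => horner_mx B (hbasis k) i j.
set h := fun (k : 'I_(size rs)) (l : C) => G 0%N l * (l - node rs k)^-1 ^+ (ordr rs k).+1.
have krs (k : 'I_(size rs)) : node rs k \in rs by exact: mem_nth.
have int1 D : D \in Gam ->
    circle_integral D (fun l => g l * invmx (l%:M - B) i j) =
    \sum_(k < size rs) (ordr rs k)`!%:R * c k * circle_integral D (h k).
  case: D => a r DG; rewrite circle_integralE.
  have r0 : 0 < r by exact: (G0 _ DG).
  have tGD m x : cabs (x - a) <= r -> is_derive x 1 (G m) (G m.+1 x).
    by move=> xD; apply: tG; exact: (DU (a, r)).
  have ch k : continuous (fun t => h k (circ a r t) * dcirc r t).
    move=> t; apply: cvgCM; last exact: continuous_dcirc.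
    apply: cvgCM.
      apply: (cvg_comp _ _ (@continuous_circ _ a r t)).
      by apply: (tower_continuous tGD); rewrite /= cabs_circ.
    have tk : circ a r t != node rs k by exact: (off (a, r)).
    exact: (cvg_comp _ _ (@continuous_circ _ a r t) (is_deriveC_continuous (is_derive_invsub _ tk))).
  rewrite (@eq_cintegral _ _ _ _ (fun t => \sum_(k < size rs)
      (ordr rs k)`!%:R * c k * (h k (circ a r t) * dcirc r t))); last first.
    move=> t; rewrite gG; last by apply: (DU (a, r)) => //=; rewrite cabs_circ.
    rewrite resolvent_hbasis; last first.
      by apply/negP => trs; have := off (a, r) _ t DG trs; rewrite eqxx.
    rewrite summxE mulr_sumr mulr_suml; apply: eq_bigr => k _.
    by rewrite mxE /h -/(c k); ring.
  rewrite cintegral_sum; last by move=> k t; apply: cvgCM; [exact: cvg_cst|exact: ch].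
  by apply: eq_bigr => k _; rewrite cintegralZ.
have int2 k : \sum_(D <- Gam) circle_integral D (h k) =
    2 * pi%:C * 'i * (G (ordr rs k) (node rs k) / (ordr rs k)`!%:R).
  have [[a r] DG [kD hE]] := sep _ (krs k).
  rewrite (bigD1_seq (a, r)) //= big_seq_cond big1 ?addr0.
    apply: (@cauchy_formula_deriv _ a r _ G) => //; first exact: (G0 _ DG).
    by move=> m x xD; apply: tG; exact: (DU (a, r)).
  move=> [b q] /andP[EG ED]; apply: (@cauchy_outside _ b q _ G) => //; first exact: (G0 _ EG).
    by move=> m x xD; apply: tG; exact: (DU (b, q)).
  exact: (hE (b, q)).
rewrite /contour_integral big_seq (eq_bigr _ int1) -big_seq exchange_big /=.
rewrite /herm raddf_sum summxE mulr_sumr; apply: eq_bigr => k _ /=.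
rewrite -mulr_sumr int2 linearZ mxE -/(c k).
have f0 : (ordr rs k)`!%:R != 0 :> C by rewrite pnatr_eq0 -lt0n fact_gt0.
have i0 : 2 * pi%:C * 'i != 0 :> C.
  rewrite !mulf_neq0 ?neq0Ci ?pnatr_eq0 //.
  by apply/eqP => -[] /eqP; rewrite gt_eqF // pi_gt0.
by move: (2 * pi%:C * 'i) i0 (_`!%:R) f0 => x x0 y y0; field; rewrite x0 y0.
Qed.

End matrix_function.
End matfun.

(** * Power series are infinitely differentiable *)

Section power_series.
Context {R : realType}.
Local Notation C := R[i].

Lemma cabs_nat k : cabs (k%:R : C) = k%:R.
Proof. by rewrite -(rmorph_nat (real_complex R)) cabs_real normr_nat. Qed.

(** A quadratic error term identifies the derivative. *)
Lemma is_derive_quad (f : C -> C) (x l : C) (d K : R) : 0 < d ->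
  (forall y, cabs (y - x) < d -> cabs (f y - f x - l * (y - x)) <= K * cabs (y - x) ^+ 2) ->
  is_derive x 1 f l.
Proof.
move=> d0 hK; apply/is_derive_slopeP.
exists (fun y => if y == x then l else (f y - f x) / (y - x)); split; last 2 first.
- by rewrite eqxx.
- move=> y; case: eqVneq => [->|yx]; first by rewrite !subrr mulr0.
  by rewrite divfK // subr_eq0.
have K0 : 0 < `|K| + 1 by rewrite ltr_wpDl.
have key y : cabs (y - x) < d ->
    cabs (l - (if y == x then l else (f y - f x) / (y - x))) <= (`|K| + 1) * cabs (y - x).
  move=> yd; case: eqVneq => [_|yx].
    by rewrite subrr /cabs normr0 mulr_ge0 ?cabs_ge0 // ltW.
  have m0 : 0 < cabs (y - x).
    rewrite lt_neqAle cabs_ge0 andbT eq_sym; apply: contra yx => /eqP m0.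
    by rewrite -subr_eq0 -normr_eq0 -cabsE m0.
  rewrite -(ler_pM2r m0) -cabsM -cabsN.
  have -> : - ((l - (f y - f x) / (y - x)) * (y - x)) = f y - f x - l * (y - x).
    by rewrite mulrBl divfK ?subr_eq0 // opprB.
  rewrite (le_trans (hK _ yd)) // expr2 mulrA; apply: ler_wpM2r; first exact: ltW.
  apply: ler_wpM2r; first exact: ltW.
  by rewrite (le_trans (ler_norm K)) // lerDl.
apply/(@cvgC_cabs R C _ (nbhs_filter x)) => e e0; rewrite eqxx.
have : (\forall y \near x, cabs (x - y) < Num.min d (e / (`|K| + 1))).
  have := (@cvgC_cabs R C _ (nbhs_filter x) id x).1 (@cvg_id _ _).
  by apply; rewrite lt_min d0 divr_gt0.
apply: filterS => y; rewrite lt_min -cabsN opprB => /andP[yd].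
rewrite ltr_pdivlMr // mulrC => h; apply: le_lt_trans (key y yd) h.
Qed.

Lemma cvg_cabs_le (u : nat -> C) (l : C) (K : R) :
  u @ \oo --> l -> (forall n, cabs (u n) <= K) -> cabs l <= K.
Proof.
move=> /cvgC_cabs ul uK; rewrite leNgt; apply/negP => Kl.
have d0 : 0 < cabs l - K by rewrite subr_gt0.
have [n _ hn] := ul _ d0.
have := hn n (leqnn n); have := cabsD (l - u n) (u n); rewrite subrK.
by have := uK n; lra.
Qed.

(** Weaker than convergence of the power series at s, but preserved by termwise
differentiation at any smaller radius. *)
Definition coef_bound (a : nat -> C) (s : R) :=
  exists M : R, forall k, cabs (a k) * s ^+ k <= M.

(** Each term of 1 + q + ... + q^(k-1) is at least q^k, and the product of this sum
with 1 - q is 1 - q^k. *)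
Lemma natmul_geometric_le (q : R) k : 0 <= q -> q < 1 -> k%:R * q ^+ k <= (1 - q)^-1.
Proof.
move=> q0 q1; have p0 : 0 < 1 - q by rewrite subr_gt0.
suff h : k%:R * q ^+ k * (1 - q) <= 1 - q ^+ k.
  rewrite -(ler_pM2r p0) mulVf ?gt_eqF // (le_trans h) // gerBl exprn_ge0 //.
elim: k => [|k ih]; first by rewrite mul0r mul0r expr0 subrr.
have qk : 0 <= q ^+ k by exact: exprn_ge0.
have : q * (k%:R * q ^+ k * (1 - q)) <= q * (1 - q ^+ k) by apply: ler_wpM2l.
have : 0 <= (1 - q) * (1 - q * q ^+ k).
  apply: mulr_ge0; first exact: ltW.
  by rewrite subr_ge0 -exprS exprn_ile1 // ltW.
by rewrite -natr1 exprS; lra.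
Qed.

Lemma coef_bound_nat (a : nat -> C) (r s : R) : 0 < r -> r < s ->
  coef_bound a s -> coef_bound (fun k => k%:R * a k) r.
Proof.
move=> r0 rs [M hM]; have s0 : 0 < s by exact: lt_trans rs.
have M0 : 0 <= M by apply: le_trans (hM 0%N); rewrite mulr_ge0 ?cabs_ge0 ?exprn_ge0 // ltW.
exists ((1 - r / s)^-1 * M) => k.
rewrite cabsM cabs_nat.
have -> : k%:R * cabs (a k) * r ^+ k = (k%:R * (r / s) ^+ k) * (cabs (a k) * s ^+ k).
  by rewrite exprMn exprVn; field; rewrite expf_neq0 // gt_eqF.
apply: ler_pM => //.
- by rewrite mulr_ge0 // exprn_ge0 // divr_ge0 // ltW.
- by rewrite mulr_ge0 ?cabs_ge0 ?exprn_ge0 // ltW.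
- apply: natmul_geometric_le; first by rewrite divr_ge0 // ltW.
  by rewrite ltr_pdivrMr // mul1r.
Qed.

Lemma coef_bound_series (a : nat -> C) (r s : R) : 0 < r -> r < s ->
  coef_bound a s -> cvgn (series (fun k => cabs (a k) * r ^+ k)).
Proof.
move=> r0 rs [M hM]; have s0 : 0 < s by exact: lt_trans rs.
have M0 : 0 <= M by apply: le_trans (hM 0%N); rewrite mulr_ge0 ?cabs_ge0 ?exprn_ge0 // ltW.
have q1 : `|r / s| < 1 by rewrite ger0_norm ?divr_ge0 ?ltW // ltr_pdivrMr // mul1r.
refine (@series_le_cvg R (fun k => cabs (a k) * r ^+ k) (geometric M (r / s)) _ _ _ (is_cvg_geometric_series q1)) => k /=.
- by rewrite mulr_ge0 ?cabs_ge0 ?exprn_ge0 // ltW.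
- by rewrite mulr_ge0 ?exprn_ge0 ?divr_ge0 // ltW.
have -> : cabs (a k) * r ^+ k = (cabs (a k) * s ^+ k) * (r / s) ^+ k.
  by rewrite exprMn exprVn; field; rewrite expf_neq0 // gt_eqF.
by apply: ler_wpM2r => //; rewrite exprn_ge0 // divr_ge0 // ltW.
Qed.

Lemma cvg_seriesC (b : nat -> C) :
  cvgn (series (fun k => cabs (b k))) -> exists l : C, series b @ \oo --> l.
Proof.
move=> h.
have cR : cvgn (series (fun k => complex.Re (b k))).
  apply: normed_cvg.
  exact: (@series_le_cvg R (fun k => `|complex.Re (b k)|) (fun k => cabs (b k))
    (fun k => normr_ge0 _) (fun k => cabs_ge0 _) (fun k => cabs_Re _) h).
have cI : cvgn (series (fun k => complex.Im (b k))).
  apply: normed_cvg.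
  exact: (@series_le_cvg R (fun k => `|complex.Im (b k)|) (fun k => cabs (b k))
    (fun k => normr_ge0 _) (fun k => cabs_ge0 _) (fun k => cabs_Im _) h).
exists (limn (series (fun k => complex.Re (b k))) +i* limn (series (fun k => complex.Im (b k)))).
have sR n : complex.Re (series b n) = series (fun k => complex.Re (b k)) n.
  by rewrite /series /= (big_morph (@complex.Re R) cReD (erefl : complex.Re (0 : C) = 0)).
have sI n : complex.Im (series b n) = series (fun k => complex.Im (b k)) n.
  by rewrite /series /= (big_morph (@complex.Im R) cImD (erefl : complex.Im (0 : C) = 0)).
apply/cvgC; split => /=.
  by under eq_fun do rewrite sR; exact: cR.
by under eq_fun do rewrite sI; exact: cI.
Qed.

(** The quadratic remainder of the k-th power, multiplied by r^2 so that the
bound has no special case for small k. *)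
Lemma pow_taylor (w y : C) (r : R) k : cabs w <= r -> cabs y <= r ->
  r ^+ 2 * cabs (y ^+ k - w ^+ k - k%:R * w ^+ k.-1 * (y - w)) <=
  k%:R ^+ 2 * r ^+ k * cabs (y - w) ^+ 2.
Proof.
move=> wr yr; have r0 : 0 <= r by exact: le_trans (cabs_ge0 w) wr.
have mX (v : C) j : cabs (v ^+ j) = cabs v ^+ j.
  elim: j => [|j ih]; first by rewrite !expr0 (cabs_real 1) normr1.
  by rewrite !exprS cabsM ih.
elim: k => [|k ih].
  by rewrite !expr0 subrr sub0r !mul0r oppr0 /cabs normr0 mulr0 expr0n /= !mul0r.
have -> : y ^+ k.+1 - w ^+ k.+1 - k.+1%:R * w ^+ k.+1.-1 * (y - w) =
  y * (y ^+ k - w ^+ k - k%:R * w ^+ k.-1 * (y - w)) + k%:R * w ^+ k.-1 * (y - w) ^+ 2.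
  case: k {ih} => [|k] /=; first by rewrite !expr0; ring.
  by rewrite -[k.+2%:R]natr1 !exprS; ring.
apply: le_trans (_ : r * (r ^+ 2 * cabs (y ^+ k - w ^+ k - k%:R * w ^+ k.-1 * (y - w))) +
   k%:R * r ^+ k.+1 * cabs (y - w) ^+ 2 <= _).
  set P := y ^+ k - _ - _; set D := y - w.
  have := cabsD (y * P) (k%:R * w ^+ k.-1 * D ^+ 2).
  rewrite !cabsM !mX => h0; have r20 : 0 <= r ^+ 2 by exact: sqr_ge0.
  apply: le_trans (ler_wpM2l r20 h0) _.
  rewrite cabs_nat mulrDr; apply: lerD.
    by rewrite mulrCA; apply: ler_wpM2r => //; rewrite mulr_ge0 ?cabs_ge0.
  have D0 : 0 <= cabs D ^+ 2 by exact: sqr_ge0.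
  rewrite [leLHS](_ : _ = r ^+ 2 * (k%:R * cabs w ^+ k.-1) * cabs D ^+ 2); last by ring.
  apply: ler_wpM2r => //.
  case: (k) => [|j] /=; first by rewrite !mul0r mulr0.
  rewrite mulrCA; apply: ler_wpM2l => //.
  rewrite -[j.+2]add2n exprD; apply: ler_wpM2l => //.
  by apply: lerXn2r => //; rewrite nnegrE ?cabs_ge0.
apply: le_trans (_ : r * (k%:R ^+ 2 * r ^+ k * cabs (y - w) ^+ 2) + k%:R * r ^+ k.+1 * cabs (y - w) ^+ 2 <= _).
  by rewrite lerD2r; apply: ler_wpM2l.
rewrite -natr1 (exprS r).
have : 0 <= (k%:R + 1) * (r * r ^+ k * cabs (y - w) ^+ 2).
  by rewrite mulr_ge0 ?addr_ge0 // mulr_ge0 ?sqr_ge0 // mulr_ge0 // exprn_ge0.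
lra.
Qed.

Lemma coef_bound_cvg (a : nat -> C) (s : R) (l : C) :
  0 <= s -> series (fun k => a k * s%:C ^+ k) @ \oo --> l -> coef_bound a s.
Proof.
move=> s0 al.
have t0 : (a k * s%:C ^+ k) @[k --> \oo] --> (0 : C).
  by apply: cvg_series_cvg_0; apply/cvg_ex; exists l.
have [N _ hN] := (cvgC_cabs _ _).1 t0 1 ltr01.
have e k : cabs (a k) * s ^+ k = cabs (a k * s%:C ^+ k).
  by rewrite cabsM -rmorphXn cabs_real ger0_norm // exprn_ge0.
exists (1 + \sum_(i < N) cabs (a i) * s ^+ i) => k.
have [kN|Nk] := ltnP k N.
  rewrite (bigD1 (Ordinal kN)) //= addrCA lerDl addr_ge0 // sumr_ge0 // => i _.
  by rewrite mulr_ge0 ?cabs_ge0 ?exprn_ge0.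
rewrite e; have := hN k Nk; rewrite sub0r cabsN => /ltW h.
by rewrite (le_trans h) // lerDl sumr_ge0 // => i _; rewrite mulr_ge0 ?cabs_ge0 ?exprn_ge0.
Qed.

(** Termwise differentiation: the second order remainders of the partial sums are
bounded by sum_k k^2 |a k| r^k, uniformly in the number of terms, and the bound
passes to the limit. *)
Lemma power_series_derive (f : C -> C) (z0 : C) (a : nat -> C) (e : R) :
  (forall z, cabs (z - z0) < e -> series (fun k => a k * (z - z0) ^+ k) @ \oo --> f z) ->
  forall z, cabs (z - z0) < e ->
  exists2 l : C, is_derive z 1 f l &
    series (fun k => k.+1%:R * a k.+1 * (z - z0) ^+ k) @ \oo --> l.
Proof.
move=> af z ze; set w := z - z0.
(* Two differentiations and one summation each cost a little of the radius; five
   equal gaps separate |w| from e. *)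
pose gap := (e - cabs w) / 5; have g0 : 0 < gap by rewrite divr_gt0 // subr_gt0.
have w0 := cabs_ge0 w.
pose r := cabs w + gap; pose s1 := r + gap; pose s2 := s1 + gap; pose s3 := s2 + gap.
have eE : e = s3 + gap by rewrite /s3 /s2 /s1 /r /gap; field.
have r0 : 0 < r by rewrite /r; lra.
have s10 : 0 < s1 by rewrite /s1; lra.
have s20 : 0 < s2 by rewrite /s2; lra.
have s30 : 0 < s3 by rewrite /s3; lra.
have rs1 : r < s1 by rewrite /s1; lra.
have s12 : s1 < s2 by rewrite /s2; lra.
have s23 : s2 < s3 by rewrite /s3; lra.
have b3 : coef_bound a s3.
  apply: (@coef_bound_cvg _ _ (f (z0 + s3%:C))); first exact: ltW.
  have := af (z0 + s3%:C); rewrite addrC addKr; apply.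
  by rewrite cabs_real gtr0_norm // eE; lra.
have b2 := coef_bound_nat s20 s23 b3.
have b1 := coef_bound_nat s10 s12 b2.
have [Kb hK] : exists Kb : R, forall n, \sum_(k < n) cabs (a k) * (k%:R ^+ 2 * r ^+ k) <= Kb.
  have := coef_bound_series r0 rs1 b1.
  set S := series _ => cS; exists (limn S) => n.
  have -> : \sum_(k < n) cabs (a k) * (k%:R ^+ 2 * r ^+ k) = S n.
    rewrite /S /series /= big_mkord; apply: eq_bigr => k _.
    by rewrite !cabsM cabs_nat; ring.
  apply: nondecreasing_cvgn_le cS _.
  apply: nondecreasing_series => k _ _; rewrite mulr_ge0 ?cabs_ge0 // exprn_ge0 //.
  exact: ltW.
have [l bl] : exists l : C, series (fun k => k.+1%:R * a k.+1 * w ^+ k) @ \oo --> l.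
  apply: cvg_seriesC.
  have bb : coef_bound (fun k => k.+1%:R * a k.+1) s1.
    have [M1 hM1] := coef_bound_nat s10 (lt_trans s12 s23) b3.
    exists (M1 / s1) => k; rewrite ler_pdivlMr // -mulrA -exprSr; exact: hM1.
  apply: (@series_le_cvg R _ _ (fun k => cabs_ge0 _) _ _ (coef_bound_series r0 rs1 bb)) => k.
    by rewrite mulr_ge0 ?cabs_ge0 // exprn_ge0 // ltW.
  rewrite cabsM; apply: ler_wpM2l; first exact: cabs_ge0.
  elim: k => [|k ih]; first by rewrite !expr0 (cabs_real 1) normr1.
  rewrite !exprS cabsM; apply: ler_pM => //; rewrite ?cabs_ge0 //.
  by rewrite /r; lra.
exists l; last exact: bl.
apply: (@is_derive_quad f z l gap (Kb / r ^+ 2)) => // y yz.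
set v := y - z0; have yzE : y - z = v - w by rewrite /v /w; ring.
rewrite yzE in yz *.
have vr : cabs v < r.
  by have := cabsD (v - w) w; rewrite subrK /r; lra.
have ve : cabs v < e by rewrite eE /s3 /s2 /s1; lra.
pose u n := series (fun k => a k * v ^+ k) n.+1 - series (fun k => a k * w ^+ k) n.+1
  - series (fun k => k.+1%:R * a k.+1 * w ^+ k) n * (v - w).
have ul : u @ \oo --> f y - f z - l * (v - w).
  apply: cvgCD; last first.
    by apply: cvgCN; apply: cvgCM; [exact: bl|exact: cvg_cst].
  apply: cvgCD; first by rewrite cvg_shiftS; exact: af.
  by apply: cvgCN; rewrite cvg_shiftS; exact: af.
apply: cvg_cabs_le ul _ => n.
have uE : u n = \sum_(k < n.+1) a k * (v ^+ k - w ^+ k - k%:R * w ^+ k.-1 * (v - w)).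
  rewrite /u /series /= !big_mkord.
  rewrite [RHS](eq_bigr (fun k : 'I_n.+1 => a k * v ^+ k - a k * w ^+ k
    - a k * (k%:R * w ^+ k.-1 * (v - w)))); last by move=> k _; ring.
  rewrite !sumrB; congr (_ - _).
  rewrite [RHS]big_ord_recl /= mul0r mul0r mulr0 add0r mulr_suml; apply: eq_bigr => k _.
  by rewrite /bump /= add1n; ring.
rewrite uE mulrAC ler_pdivlMr ?exprn_gt0 // mulrC.
apply: le_trans (_ : \sum_(k < n.+1) cabs (a k) * (k%:R ^+ 2 * r ^+ k) * cabs (v - w) ^+ 2 <= _); last first.
  by rewrite -mulr_suml; apply: ler_wpM2r; [exact: sqr_ge0|exact: hK].
apply: le_trans (_ : r ^+ 2 * \sum_(k < n.+1) cabs (a k * (v ^+ k - w ^+ k - k%:R * w ^+ k.-1 * (v - w))) <= _).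
  apply: ler_wpM2l; first exact: sqr_ge0.
  elim: (n.+1) => [|m ih]; first by rewrite !big_ord0 /cabs normr0.
  by rewrite !big_ord_recr /=; apply: le_trans (cabsD _ _) _; rewrite lerD2r.
rewrite mulr_sumr; apply: ler_sum => k _; rewrite cabsM mulrCA -[leRHS]mulrA.
apply: ler_wpM2l; first exact: cabs_ge0.
apply: pow_taylor; last exact: ltW.
by rewrite /r; lra.
Qed.

Lemma analytic_derive (f : C -> C) (z0 : C) : analytic_at f z0 ->
  derivable f z0 1 /\ analytic_at (f^`())%classic z0.
Proof.
move=> [e [a [e0 af]]].
have af' z : cabs (z - z0) < e -> series (fun k => a k * (z - z0) ^+ k) @ \oo --> f z.
  by move=> h; apply: af; rewrite -cabsE ltcR.
have h := power_series_derive af'; split.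
  have [|l [d _] _] := h z0; first by rewrite subrr /cabs normr0.
  exact: d.
exists e, (fun k => k.+1%:R * a k.+1); split; first exact: e0.
move=> z; rewrite -cabsE ltcR => ze.
have [l [d dl] sl] := h z ze.
by rewrite derive1E dl.
Qed.

Lemma analytic_tower (U : set C) (f : C -> C) :
  analytic_on U f -> tower U (fun k => derive1n k f).
Proof.
move=> aU k x Ux; rewrite derive1nS derive1E.
have ak : analytic_at (derive1n k f) x.
  elim: k => [|k ih]; first exact: aU.
  by rewrite derive1nS; have [] := analytic_derive ih.
have [d _] := analytic_derive ak.
exact: DeriveDef.
Qed.

End power_series.

(** * Derivatives of products and quotients *)

Section towers.
Context {R : realType}.
Local Notation C := R[i].

Lemma is_deriveC_sum (I : Type) (r : seq I) (F : I -> C -> C) (x : C) (w : I -> C) :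
  (forall i, is_derive x 1 (F i) (w i)) ->
  is_derive x 1 (fun y => \sum_(i <- r) F i y) (\sum_(i <- r) w i).
Proof.
move=> dF; elim: r => [|i r ih].
  rewrite big_nil (_ : (fun y => _) = fun=> 0); first exact: is_deriveC_cst.
  by apply/funext => y; rewrite big_nil.
rewrite big_cons (_ : (fun y => _) = fun y => F i y + \sum_(j <- r) F j y).
  exact: is_deriveCD.
by apply/funext => y; rewrite big_cons.
Qed.

Lemma is_deriveC_horner (p : {poly C}) (x : C) : is_derive x 1 (horner p) p^`().[x].
Proof.
elim/poly_ind: p => [|p c ih].
  rewrite deriv0 horner0 (_ : horner 0 = fun=> 0); first exact: is_deriveC_cst.
  by apply/funext => y; rewrite horner0.
rewrite (_ : horner (p * 'X + c%:P) = fun y => p.[y] * y + c); last first.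
  by apply/funext => y; rewrite !hornerE.
have di : is_derive x 1 (fun y : C => y) 1 by exact: is_derive_id.
have := is_deriveCD (is_deriveCM ih di) (is_deriveC_cst c x).
by rewrite derivD derivC derivM derivX !hornerE.
Qed.

(** Any explicit tower computes the iterated derivatives, because equality on an
open set is inherited by derivatives. *)
Lemma tower_derive1n (U : set C) (G : nat -> C -> C) (f : C -> C) :
  open U -> tower U G -> (forall x, U x -> f x = G 0%N x) ->
  forall k x, U x -> derive1n k f x = G k x.
Proof.
move=> oU tG fG; elim=> [|k ih] x Ux; first exact: fG.
rewrite derive1nS derive1E.
have [_ <-] := tG k x Ux.
apply: near_eq_derive.
have : nbhs x U by exact: open_nbhs_nbhs.
by apply: filterS => y; exact: ih.
Qed.

Lemma tower_uniq (U : set C) (G H : nat -> C -> C) :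
  open U -> tower U G -> tower U H -> (forall x, U x -> G 0%N x = H 0%N x) ->
  forall k x, U x -> G k x = H k x.
Proof.
move=> oU tG tH GH k x Ux.
rewrite -(@tower_derive1n U G (G 0%N) oU tG _ k x Ux) //.
exact: tower_derive1n oU tH GH k x Ux.
Qed.

Lemma tower_leib (U : set C) (G H : nat -> C -> C) :
  tower U G -> tower U H -> tower U (fun n x => leib (G ^~ x) (H ^~ x) n).
Proof.
move=> tG tH k x Ux; rewrite -leibS /leib.
apply: is_deriveC_sum => i.
have := is_deriveCM (tG i x Ux) (tH (k - i)%N x Ux).
move=> /(is_deriveCM (is_deriveC_cst ('C(k, i)%:R) x)); rewrite mul0r add0r mulr_natl.
rewrite (_ : (fun y => _ * _) = (fun y => (G i y * H (k - i)%N y) *+ 'C(k, i))) //.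
by apply/funext => y; rewrite mulr_natl.
Qed.

Lemma tower_pjet (p : {poly C}) : tower setT (fun n x => pjet p x n).
Proof. by move=> k x _; rewrite /pjet derivnS; exact: is_deriveC_horner. Qed.

Lemma towerS (U V : set C) G : U `<=` V -> tower V G -> tower U G.
Proof. by move=> UV tG k x /UV; exact: tG. Qed.

Lemma open_horner_neq0 (v : {poly C}) : open [set a : C | v.[a] != 0].
Proof.
rewrite openE => x vx; rewrite /interior.
have cv : v.[y] @[y --> x] --> v.[x] by exact: (is_deriveC_continuous (is_deriveC_horner v x)).
exact: cvgr_neq0 cv vx.
Qed.

(** The k-th derivative of u / v is ratnum u v k / v^(k+1). *)
Fixpoint ratnum (u v : {poly C}) k : {poly C} :=
  if k is k'.+1 then (ratnum u v k')^`() * v - k'.+1%:R *: (ratnum u v k' * v^`()) else u.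

Definition rattower (u v : {poly C}) k (x : C) : C := (ratnum u v k).[x] * v.[x]^-1 ^+ k.+1.

Lemma tower_rat (u v : {poly C}) : tower [set a | v.[a] != 0] (rattower u v).
Proof.
move=> k x /= vx; rewrite /rattower.
have d1 := @is_derive_compK C (fun y => (y - 0)^-1 ^+ k.+1) (horner v) x _ _
   (is_derive_invsub k.+1 vx) (is_deriveC_horner v x).
have := is_deriveCM (is_deriveC_horner (ratnum u v k) x) d1.
rewrite /= !subr0.
rewrite (_ : (fun y => (ratnum u v k).[y] * (v.[y] - 0)^-1 ^+ k.+1) =
   (fun y => (ratnum u v k).[y] * v.[y]^-1 ^+ k.+1)); last first.
  by apply/funext => y; rewrite subr0.
rewrite (_ : _ + _ = (ratnum u v k.+1).[x] * v.[x]^-1 ^+ k.+2) //.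
have -> : ratnum u v k.+1 = (ratnum u v k)^`() * v - k.+1%:R *: (ratnum u v k * v^`()) by [].
move: (ratnum u v k) (k.+1%:R : C) => p c.
rewrite hornerD hornerN hornerZ !hornerM !exprS; move: (v.[x]^-1 ^+ k) => w.
by field.
Qed.

(** Leibniz' rule for v * (u / v) = u. *)
Lemma rat_leib (u v : {poly C}) x j : v.[x] != 0 ->
  leib (pjet v x) (rattower u v ^~ x) j = pjet u x j.
Proof.
move=> vx.
apply: (@tower_uniq [set a | v.[a] != 0] (fun n x => leib (pjet v x) (rattower u v ^~ x) n)
          (fun n x => pjet u x n) _ _ _ _ j x vx).
- exact: open_horner_neq0.
- by apply: tower_leib; [apply: towerS (@tower_pjet v)|exact: tower_rat].
- exact: towerS (@tower_pjet u).
- move=> y vy; rewrite /leib big_ord_recl big_ord0 addr0 /= /rattower /pjet !derivn0 /=.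
  by rewrite mulrCA expr1 mulfV // mulr1.
Qed.

End towers.

(** * The remainder of Hermite interpolation *)

Section mean_value.
Context {R : realType}.
Local Notation C := R[i].

Lemma cderiveX (s : R) j : cderive (fun s => s%:C ^+ j : C) s (j%:R * s%:C ^+ j.-1).
Proof.
elim: j => [|j ihj]; first by rewrite mul0r; exact: cderive_cst.
  have dS : cderive (fun s => s%:C : C) s (1%:C) by exact: cderive_real.
  have := cderiveM dS ihj.
  rewrite (_ : (fun s => s%:C * s%:C ^+ j) = (fun s => s%:C ^+ j.+1 : C)); last first.
    by apply/funext => t; rewrite exprS.
  rewrite mul1r (_ : _ + _ = j.+1%:R * s%:C ^+ j.+1.-1) //=.
  by case: j {ihj} => [|j]; rewrite ?mul0r ?mulr0 ?addr0 ?mul1r //= -[j.+2%:R]natr1 exprS; ring.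
Qed.

(** The real mean value theorem, applied to the component of phi in the direction
of phi 1 - phi 0 minus the primitive of the bound on phi'. *)
Lemma mean_value_pow (phi phi' : R -> C) (B : R) (n : nat) :
  (forall s, 0 <= s <= 1 -> cderive phi s (phi' s)) ->
  (forall s, 0 <= s <= 1 -> cabs (phi' s) <= B * s ^+ n) ->
  cabs (phi 1 - phi 0) <= B / n.+1%:R.
Proof.
move=> dphi hB; set u := phi 1 - phi 0.
have [u0|u0] := eqVneq (cabs u) 0.
  rewrite u0 divr_ge0 //; have := hB 1; rewrite ler01 lexx expr1n mulr1 => /(_ isT).
  exact: le_trans (cabs_ge0 _).
have mu0 : 0 < cabs u by rewrite lt_neqAle eq_sym u0 cabs_ge0.
pose k := cabs u * (B / n.+1%:R).
pose psi (s : R) : C := u^*%C * phi s + (- k)%:C * s%:C ^+ n.+1.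
pose psi' (s : R) : C := u^*%C * phi' s + (- k)%:C * (n.+1%:R * s%:C ^+ n).
pose g s := complex.Re (psi s); pose g' s := complex.Re (psi' s).
have realE (a s : R) m : complex.Re (a%:C * s%:C ^+ m) = a * s ^+ m.
  by rewrite -rmorphXn -rmorphM.
have gE s : g s = complex.Re (u^*%C * phi s) - k * s ^+ n.+1.
  by rewrite /g /psi cReD realE mulNr.
have g'E s : g' s = complex.Re (u^*%C * phi' s) - k * (n.+1%:R * s ^+ n).
  rewrite /g' /psi' cReD -(rmorph_nat (real_complex R)) mulrA -rmorphM realE.
  by rewrite !mulNr mulrA.
have dg (s : R) : 0 <= s <= 1 -> is_derive s 1 g (g' s).
  move=> s01.
  by have [] := cderiveD (cderiveZ u^*%C (dphi s s01)) (cderiveZ (- k)%:C (cderiveX s n.+1)).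
have cg : {within `[0, 1], continuous g}.
  apply: derivable_within_continuous => s; rewrite in_itv /= => s01.
  by have [d _] := dg s s01; exact: d.
have dg' (s : R) : s \in `]0, 1[ -> is_derive s 1 g (g' s).
  by rewrite in_itv /= => /andP[s0 s1]; apply: dg; rewrite !ltW.
have [c c01 e] := MVT_segment ler01 dg' cg.
rewrite in_itv /= in c01; have /andP[c0 c1] := c01.
have mconj : cabs u^*%C = cabs u by rewrite /cabs normcJ.
have gc : g' c <= 0.
  rewrite g'E subr_le0 /k.
  have -> : cabs u * (B / n.+1%:R) * (n.+1%:R * c ^+ n) = cabs u * (B * c ^+ n).
    by rewrite -mulrA; congr (_ * _); rewrite mulrA divfK // pnatr_eq0.
  apply: le_trans (ler_norm _) _; apply: le_trans (cabs_Re _) _.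
  by rewrite cabsM mconj; apply: ler_wpM2l; [exact: ltW|exact: hB].
have : g 1 - g 0 <= 0 by rewrite e subr0 mulr1.
rewrite !gE /k expr1n expr0n /= mulr0 mulr1 subr0 addrAC -cReN -cReD -mulrBr -/u.
have -> : u^*%C * u = (cabs u * cabs u)%:C.
  by rewrite rmorphM /= !cabsE -expr2 sqr_normc mulrC.
rewrite /=.
by rewrite subr_le0 ler_pM2l.
Qed.

End mean_value.

Section divided_difference.
Context {R : realType}.
Local Notation C := R[i].
Variables (rs : seq C) (l : {poly C} -> C).
Hypothesis lD : forall p q, l (p + q) = l p + l q.
Hypothesis lZ : forall c p, l (c *: p) = c * l p.
Hypothesis l_rs : forall p, nodal rs %| p -> l p = 0.

Lemma l_sum (I : Type) (r : seq I) (F : I -> {poly C}) :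
  l (\sum_(i <- r) F i) = \sum_(i <- r) l (F i).
Proof.
have l0 : l 0 = 0 by rewrite -(scale0r 0) lZ mul0r.
by elim: r => [|i r ih]; rewrite ?big_nil // !big_cons lD ih.
Qed.

(** The value of the linear form l at the divided difference on the nodes zs and
the points rs.  As l vanishes on the multiples of [nodal rs], only the quotient
modulo [nodal rs] matters, and any interpolant may be used ([ddiff_poly]). *)
Definition ddiff (zs : seq C) (J : C -> nat -> C) : C :=
  l (herm (zs ++ rs) J %/ nodal zs).

Lemma ddiff_poly zs J p : jets_eq (zs ++ rs) (pjet p) J -> ddiff zs J = l (p %/ nodal zs).
Proof.
move=> h; have /dvdpP[k e] := herm_unique h.
have z0 : nodal zs != 0 by rewrite monic_neq0 // monic_nodal.
rewrite /ddiff -[herm _ _](subrK p) e nodal_cat divpD lD.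
by rewrite mulrCA mulrC mulpK // [X in X + _]l_rs ?add0r // dvdp_mulIr.
Qed.

Lemma ddiffE zs J : ddiff zs J = \sum_(i < size (zs ++ rs))
  J (node (zs ++ rs) i) (ordr (zs ++ rs) i) * l (hbasis i %/ nodal zs).
Proof.
rewrite /ddiff /herm -[X in l X](_ : \sum_(i < size (zs ++ rs))
   J (node (zs ++ rs) i) (ordr (zs ++ rs) i) *: (hbasis i %/ nodal zs) = _).
  by rewrite l_sum; apply: eq_bigr => i _; rewrite lZ.
elim/big_rec2: _ => [|i y x _ ->]; first by rewrite div0p.
by rewrite divpD divpZl.
Qed.

(** Leibniz' rule for the product of 'X - c and a function with jets J; for j = 0
the second term vanishes. *)
Definition jet_XsubM (c : C) (J : C -> nat -> C) x j :=
  (x - c) * J x j + j%:R * J x j.-1.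

(** The node c cancels the factor 'X - c. *)
Lemma ddiff_XsubM c zs J : ddiff (c :: zs) (jet_XsubM c J) = ddiff zs J.
Proof.
rewrite (@ddiff_poly _ _ (('X - c%:P) * herm (zs ++ rs) J)).
  by rewrite nodal_cons divp_pmul2l // monic_neq0 // ?monicXsubC ?monic_nodal.
move=> x j /= jc; rewrite /jet_XsubM.
case: j jc => [|j] jc.
  rewrite mul0r addr0 /pjet derivn0 !hornerE.
  have [->|xc] := eqVneq x c; first by rewrite subrr !mul0r.
  rewrite eq_sym (negbTE xc) in jc.
  by rewrite -[(herm _ _).[x]]/(pjet (herm (zs ++ rs) J) x 0) herm_jets.
rewrite /pjet derivn_XsubCM !hornerE hornerMn.
rewrite -[(herm _ _)^`(j.+1).[x]]/(pjet (herm (zs ++ rs) J) x j.+1).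
rewrite -[(herm _ _)^`(j).[x]]/(pjet (herm (zs ++ rs) J) x j).
have [xc|xc] := eqVneq x c.
  rewrite xc subrr !mul0r !add0r herm_jets; first by rewrite mulr_natl.
  by move: jc; rewrite xc eqxx add1n.
rewrite eq_sym (negbTE xc) add0n in jc.
by rewrite !herm_jets // ?(ltnW jc) // mulr_natl.
Qed.

(** The pairs (t, m) such that m + t x runs, for fixed x, through the simplex with
vertices x and zs.  The recursion performs the contraction towards the first
vertex on which the induction in [ddiff_bound] relies. *)
Fixpoint simplex_set (zs : seq C) : set (R * C) :=
  if zs is c :: s then
    [set p | exists sg t m, [/\ 0 <= sg <= 1, simplex_set s (t, m) &
       p = (sg * t, (1 - sg)%:C * c + sg%:C * m)]]
  else [set (1, 0)].

(** Convexity with real weights. *)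
Definition segment_closed (K : set C) := forall x y (t : R), K x -> K y -> 0 <= t <= 1 ->
  K ((1 - t)%:C * x + t%:C * y).

Variable K : set C.
Hypothesis cK : segment_closed K.
Hypothesis rsK : [set` rs] `<=` K.

(** The mean value form of the Hermite-Genocchi formula, by contraction towards
the first node: its derivative in the ratio s is a divided difference on the
other nodes, of order one less, of a function whose highest derivative carries
the factor s^(size zs). *)
Lemma ddiff_bound (zs : seq C) (G : nat -> C -> C) (M : R) :
  [set` zs] `<=` K -> tower K G ->
  (forall t m, simplex_set zs (t, m) ->
     cabs (l (herm rs (fun x j => t%:C ^+ j * G (size zs + j)%N (m + t%:C * x)))) <= M) ->
  cabs (ddiff zs (fun x j => G j x)) <= M / (size zs)`!%:R.
Proof.
elim: zs G M => [|c zs ih] G M zsK tG hM.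
  rewrite fact0 divr1 /ddiff /nodal big_nil divp1 /=.
  have := hM 1 0 (erefl _); rewrite /=.
  under eq_fun do under eq_fun do rewrite expr1n mul1r add0n mul1r add0r.
  by [].
have Kc : K c by apply: zsK; rewrite /= inE eqxx.
have zsK' : [set` zs] `<=` K by move=> x xs; apply: zsK; rewrite /= inE; apply/orP; right.
pose S := (c :: zs) ++ rs.
have SK i : (i < size S)%N -> K (node S i).
  move=> iS; have : node S i \in S by exact: mem_nth.
  rewrite /S mem_cat => /orP[h|h]; [exact: zsK|exact: rsK].
pose at_ s x := (1 - s)%:C * c + s%:C * x : C.
pose Gs (s : R) x j := s%:C ^+ j * G j (at_ s x).
pose H (s : R) k x := s%:C ^+ k * G k.+1 (at_ s x).
have tH s : 0 <= s <= 1 -> tower K (H s).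
  move=> s01 k x Kx.
  have dA : is_derive x 1 (at_ s) s%:C by exact: is_derive_affine.
  have d1 := @is_derive_compK C (G k.+1) (at_ s) x _ _ (tG k.+1 _ (cK Kc Kx s01)) dA.
  have := is_deriveCM (is_deriveC_cst (s%:C ^+ k) x) d1.
  rewrite mul0r add0r /H exprSr mulrAC mulrA => h.
  exact: h.
pose phi s := ddiff (c :: zs) (Gs s).
pose phi' s := ddiff zs (fun x j => H s j x).
have dat x (s : R) : cderive (at_ ^~ x) s (x - c).
  have dS : cderive (fun s => s%:C : C) s (1%:C) by exact: cderive_real.
  have d1 := cderiveD (cderive_cst c s) (cderiveM dS (cderive_cst (x - c) s)).
  move: d1; rewrite add0r mulr0 addr0 mul1r.
  rewrite (_ : (fun s => c + s%:C * (x - c)) = at_ ^~ x) //.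
  by apply/funext => t; rewrite /at_ rmorphB rmorph1; ring.
have dphi s : 0 <= s <= 1 -> cderive phi s (phi' s).
  move=> s01; rewrite /phi' -(ddiff_XsubM c) /phi.
  have -> : (fun s => ddiff (c :: zs) (Gs s)) = fun s => \sum_(i < size S)
      Gs s (node S i) (ordr S i) * l (hbasis i %/ nodal (c :: zs)).
    by apply/funext => t; rewrite ddiffE.
  rewrite ddiffE; apply: cderive_sum => i.
  have Kx := SK i (ltn_ord i).
  set x := node S i; set j := ordr S i.
  have dG : cderive (fun s => G j (at_ s x)) s (G j.+1 (at_ s x) * (x - c)).
    exact: (@cderive_comp _ (G j) (at_ ^~ x) s _ _ (tG j _ (cK Kc Kx s01)) (dat x s)).
  have := cderiveM (cderiveM (cderiveX s j) dG) (cderive_cst (l (hbasis i %/ nodal (c :: zs))) s).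
  rewrite mulr0 addr0 (_ : _ * _ + _ = jet_XsubM c (fun x j => H s j x) x j) //.
  rewrite /jet_XsubM /H; case: (j) => [|j'] /=; first by rewrite !mul0r; ring.
  by ring.
have bphi s : 0 <= s <= 1 -> cabs (phi' s) <= M / (size zs)`!%:R * s ^+ size zs.
  move=> s01; have s0 : 0 <= s by case/andP: s01.
  rewrite mulrAC; apply: ih => //; first exact: tH.
  move=> t m Qtm.
  have := hM (s * t) ((1 - s)%:C * c + s%:C * m).
  have Qc : simplex_set (c :: zs) (s * t, (1 - s)%:C * c + s%:C * m) by exists s, t, m.
  move=> /(_ Qc) h.
  set J := (X in herm rs X) in h.
  have -> : (fun x j => t%:C ^+ j * H s (size zs + j)%N (m + t%:C * x)) =
     fun x j => s%:C ^+ size zs * J x j.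
    apply/funext => x; apply/funext => j; rewrite /J /H /at_ /= addSn rmorphM /= exprMn exprD.
    rewrite (_ : _ * c + s%:C * (m + t%:C * x) = (1 - s)%:C * c + s%:C * m + s%:C * t%:C * x).
      by ring.
    by ring.
  rewrite hermZ lZ cabsM -rmorphXn cabs_real ger0_norm ?exprn_ge0 // mulrC.
  by apply: ler_wpM2r => //; exact: exprn_ge0.
have := mean_value_pow dphi bphi.
rewrite -mulrA -invfM -natrM mulnC -factS.
have -> : phi 1 = ddiff (c :: zs) (fun x j => G j x).
  rewrite /phi; congr ddiff; apply/funext => x; apply/funext => j.
  by rewrite /Gs /at_ subrr mul0r add0r mul1r expr1n mul1r.
have -> : phi 0 = 0; last by rewrite subr0.
rewrite /phi (@ddiff_poly _ _ (G 0%N c)%:P).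
  rewrite divp_small; first by rewrite -(scale0r 0) lZ mul0r.
  by rewrite size_nodal /= (leq_ltn_trans (size_polyC_leq1 _)).
move=> x [|j] _; rewrite /pjet /Gs /at_ ?derivn0 ?derivnC /= ?hornerE ?subr0 ?mul1r ?mul0r ?addr0 ?expr0n /= ?mul0r //.
Qed.

End divided_difference.

(** * Convex hulls of finite sets *)

Section hull.
Context {R : realType}.
Local Notation C := R[i].

Lemma convex_setC (A : set C) : @convex_set C C A <-> segment_closed A.
Proof.
split=> [cA x y t Ax Ay /andP[t0 t1]|cA x y lam].
  have t0' : 0 <= (1 - t)%:C by rewrite (lecR 0) subr_ge0.
  have t1' : (1 - t)%:C <= 1 by rewrite (lecR _ 1) gerBl.
  have := cA x y (Itv01 t0' t1') (mem_set Ax) (mem_set Ay) => /set_mem.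
  rewrite /conv /=.
  rewrite (_ : _ *: x + _ *: y = (1 - t)%:C * x + t%:C * y) //.
  by congr (_ + _ * _); rewrite /unstable.onem rmorphB rmorph1 opprB addrC subrK.
move=> /set_mem Ax /set_mem Ay; apply/mem_set.
have l0 : 0 <= lam%:num by [].
have l1 : lam%:num <= 1 by [].
move: l0 l1; rewrite /conv /=; move: (lam%:num) => [a b].
rewrite !lecE /= => /andP[/eqP b0 a0] /andP[_ a1].
have -> : a +i* b = (1 - (1 - a))%:C by rewrite b0; congr (_ +i* _); ring.
have -> : (1 - (1 - a))%:C *: x + unstable.onem (1 - (1 - a))%:C *: y
    = (1 - (1 - a))%:C * x + (1 - a)%:C * y.
  by congr (_ + _ * _); rewrite /unstable.onem !rmorphB rmorph1; ring.
by apply: cA => //; apply/andP; split; lra.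
Qed.

Lemma hull_segment_closed (S : set C) : segment_closed (convex_hull S).
Proof.
move=> x y t hx hy t01 A [cA SA].
have /convex_setC h := cA.
by apply: h => //; [exact: hx|exact: hy].
Qed.

Lemma sub_hull (S : set C) : S `<=` convex_hull S.
Proof. exact: sub_gen_smallest. Qed.

Lemma hull_sub (S A : set C) : segment_closed A -> S `<=` A -> convex_hull S `<=` A.
Proof. by move=> /convex_setC cA SA; exact: smallest_sub. Qed.

(** Built by joining one vertex at a time, so that it is visibly a continuous image
of [0, 1] x K with K compact. *)
Fixpoint join_hull (c : C) (s : seq C) : set C :=
  if s is d :: s' then
    [set p | exists t m, [/\ 0 <= t <= 1, join_hull d s' m & p = (1 - t)%:C * c + t%:C * m]]
  else [set c].

(** A segment between two points of a cone with vertex c projects from c to a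
segment of its base; S is the weight of the base. *)
Lemma join_hull_closed c s : segment_closed (join_hull c s).
Proof.
elim: s c => [|d s ih] c x y t /=.
  by move=> -> -> _; rewrite -mulrDl rmorphB rmorph1 subrK mul1r.
move=> [p [m [p01 Km ->]]] [q [k [q01 Kk ->]]] t01.
have [/andP[p0 p1] /andP[q0 q1] /andP[t0 t1]] := And3 p01 q01 t01.
pose S := (1 - t) * p + t * q.
have a0 : 0 <= (1 - t) * p by rewrite mulr_ge0 // subr_ge0.
have b0 : 0 <= t * q by rewrite mulr_ge0.
have S01 : 0 <= S <= 1.
  rewrite addr_ge0 //=; have h1 : (1 - t) * p <= (1 - t) by rewrite ler_piMr // subr_ge0.
  have h2 : t * q <= t by rewrite ler_piMr.
  by rewrite /S; lra.
have [S0|S0] := eqVneq S 0.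
  have ap : (1 - t) * p = 0 by apply/eqP; rewrite eq_le a0 andbT -S0 /S lerDl.
  have bq : t * q = 0 by apply/eqP; rewrite eq_le b0 andbT -S0 /S lerDr.
  exists 0, m; split; rewrite ?lexx ?ler01 // subr0 mul0r addr0 mul1r.
  transitivity ((1 - ((1 - t) * p) - t * q)%:C * c + ((1 - t) * p)%:C * m + (t * q)%:C * k).
    by rewrite !(rmorphB, rmorphM, rmorph1); ring.
  by rewrite ap bq !subr0 !mul0r !addr0 mul1r.
have SC : S%:C != 0 :> C by apply/eqP => -[] /eqP; rewrite (negbTE S0).
have Sp : 0 < S by rewrite lt_neqAle eq_sym S0; case/andP: S01.
exists S, ((1 - t * q / S)%:C * m + (t * q / S)%:C * k); split => //.
  apply: ih => //; rewrite divr_ge0 ?(ltW Sp) //= ler_pdivrMr // mul1r /S lerDr //.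
have -> : (t * q / S)%:C = (t * q)%:C / S%:C :> C by rewrite rmorphM fmorphV.
rewrite [(1 - t * q / S)%:C](_ : _ = ((1 - t) * p)%:C / S%:C); last first.
  by rewrite -fmorphV -rmorphM; congr (_%:C); rewrite /S in Sp *; field; rewrite gt_eqF.
have -> : (1 - S)%:C = 1 - ((1 - t) * p)%:C - (t * q)%:C :> C.
  by rewrite /S !(rmorphB, rmorphD, rmorph1); ring.
move: (S%:C) SC => s' s0.
rewrite !(rmorphB, rmorphM, rmorph1); field.
by [].
Qed.

Lemma join_hull_sub (A : set C) c s : segment_closed A -> [set` c :: s] `<=` A ->
  join_hull c s `<=` A.
Proof.
move=> cA; elim: s c => [|d s ih] c csA x /=.
  by move=> ->; apply: csA; rewrite /= inE.
move=> [t [m [t01 Km ->]]]; apply: cA => //; first by apply: csA; rewrite /= inE eqxx.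
by apply: ih Km => y yds; apply: csA; rewrite /= inE; apply/orP; right.
Qed.

Lemma join_hull_mem c s : [set` c :: s] `<=` join_hull c s.
Proof.
elim: s c => [|d s ih] c x; first by rewrite /= inE => /eqP.
rewrite /= inE => /predU1P[->|xs].
  exists 0, d; split; rewrite ?lexx ?ler01 //; first by apply: ih; rewrite /= inE eqxx.
  by rewrite subr0 mul1r mul0r addr0.
exists 1, x; split; rewrite ?lexx ?ler01 //; first exact: ih.
by rewrite subrr mul1r mul0r add0r.
Qed.

Lemma hullE c s : convex_hull [set` c :: s] = join_hull c s.
Proof.
apply/seteqP; split.
  by apply: hull_sub; [exact: join_hull_closed|exact: join_hull_mem].
by apply: join_hull_sub; [exact: hull_segment_closed|exact: sub_hull].
Qed.

Lemma compact_join_hull c s : compact (join_hull c s).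
Proof.
elim: s c => [|d s ih] c; first exact: compact_set1.
have -> : join_hull c (d :: s) =
    (fun p : R * C => (1 - p.1)%:C * c + p.1%:C * p.2) @` (`[0, 1] `*` join_hull d s).
  apply/seteqP; split => x.
    by move=> [t [m [t01 Km ->]]]; exists (t, m) => //; split => //=; rewrite in_itv.
  by move=> [[t m] [/= + Km] <-]; rewrite in_itv => t01; exists t, m.
apply: continuous_compact; last by apply: compact_setX; [exact: segment_compact|exact: ih].
apply: continuous_subspaceT => p.
have c1 : p'.1 @[p' --> p] --> p.1 by exact: cvg_fst.
have c2 : p'.2 @[p' --> p] --> p.2 by exact: cvg_snd.
have c3 : (1 - p'.1)%:C @[p' --> p] --> ((1 - p.1)%:C : C).
  by apply: cvgC_real; apply: cvgB => //; exact: cvg_cst.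
exact: (cvgCD (cvgCM c3 (cvg_cst c)) (cvgCM (cvgC_real c1) c2)).
Qed.

(** The weight 1 - t that is left to the nodes can be factored out, except when
t = 1, where any point of the hull will do. *)
Lemma simplex_setP (c : C) (s : seq C) (t : R) (m : C) : simplex_set (c :: s) (t, m) ->
  0 <= t <= 1 /\ exists2 mu, convex_hull [set` c :: s] mu & m = (1 - t)%:C * mu.
Proof.
elim: s c t m => [|d s ih] c t m.
  move=> [sg [t' [m' [sg01 [-> ->] [-> ->]]]]]; rewrite mulr1; split => //.
  by exists c; [apply: sub_hull; rewrite /= inE|rewrite mulr0 addr0].
move=> [sg [t' [m' [sg01 /ih[t01 [mu Kmu ->]] [-> ->]]]]].
have [/andP[s0 s1] /andP[t0 t1]] := conj sg01 t01.
have st1 : sg * t' <= 1 by rewrite mulr_ile1.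
split; first by rewrite mulr_ge0.
have hc : convex_hull [set` [:: c, d & s]] c by apply: sub_hull; rewrite /= inE eqxx.
have hmu : convex_hull [set` [:: c, d & s]] mu.
  apply: hull_sub Kmu; first exact: hull_segment_closed.
  by move=> x xs; apply: sub_hull; rewrite /= inE; apply/orP; right.
have [T0|T0] := eqVneq (sg * t') 1.
  have sg1 : sg = 1 by apply/eqP; rewrite eq_le s1 -T0 ler_piMr.
  have t'1 : t' = 1 by move: T0; rewrite sg1 mul1r.
  by exists c => //; rewrite sg1 t'1 mulr1 subrr !mul0r mulr0 addr0.
have Tp : 0 < 1 - sg * t' by rewrite subr_gt0 lt_neqAle T0.
pose w := sg * (1 - t') / (1 - sg * t').
have w0 : 0 <= sg * (1 - t') by rewrite mulr_ge0 // subr_ge0.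
exists ((1 - w)%:C * c + w%:C * mu).
  apply: hull_segment_closed => //; rewrite divr_ge0 ?(ltW Tp) //= ler_pdivrMr // mul1r.
  by rewrite mulrBr mulr1 lerD2r.
rewrite mulrDr !mulrA -!rmorphM /=.
by congr (_%:C * _ + _%:C * _); rewrite /w; field; rewrite gt_eqF.
Qed.

End hull.

(** * The error bound *)

Section main.
Context {R : realType}.
Local Notation C := R[i].

Lemma cformD n (d : 'cV[C]_n) (X Y : 'M[C]_n) b :
  cform d (X + Y) b = cform d X b + cform d Y b.
Proof. by rewrite /cform mulmxDr mulmxDl mxE. Qed.

Lemma cformZ n (d : 'cV[C]_n) c (X : 'M[C]_n) b :
  cform d (c *: X) b = c * cform d X b.
Proof. by rewrite /cform -scalemxAr -scalemxAl mxE. Qed.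

(** The roots of the characteristic polynomial, by Cayley-Hamilton. *)
Lemma spectrum_nodal n (A : 'M[C]_n.+1) :
  exists rs : seq C, horner_mx A (nodal rs) = 0 /\ [set` rs] = spectrum A.
Proof.
have [rs e] := closed_field_poly_normal (char_poly A).
rewrite (monicP (char_poly_monic A)) scale1r in e.
exists rs; split; first by rewrite -[nodal rs]e Cayley_Hamilton.
apply/seteqP; split => x; rewrite /spectrum /= eigenvalue_root_char e;
  by rewrite root_prod_XsubC.
Qed.

Lemma spectrum_affine n (A : 'M[C]_n) (a q x : C) :
  spectrum A x -> spectrum (a%:M + q *: A) (a + q * x).
Proof.
rewrite /spectrum /= => /eigenvalueP[w wA w0]; apply/eigenvalueP; exists w => //.
by rewrite mulmxDr mul_mx_scalar -scalemxAr wA scalerA scalerDl.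
Qed.

Section matrix.
Variables (n : nat) (A : 'M[C]_n.+1) (rs : seq C).
Hypothesis rs0 : horner_mx A (nodal rs) = 0.
Hypothesis rsA : [set` rs] = spectrum A.

Lemma matfun_poly (p : {poly C}) : matfun setT (fun x => p.[x]) A = horner_mx A p.
Proof.
rewrite (@matfun_herm _ _ A rs rs0 _ setT _ (fun n x => pjet p x n)) //.
- by apply: (dvdp_horner_mx rs0); exact: herm_unique.
- by rewrite rsA.
- exact: openT.
- exact: tower_pjet.
Qed.

(** g(a + q A) is a function of A even when q = 0: its interpolation points
are the images of those of A. *)
Lemma matfun_affine (U : set C) (g : C -> C) (G : nat -> C -> C) (a q : C) :
  open U -> tower U G -> (forall x, U x -> g x = G 0%N x) ->
  (forall x, spectrum A x -> U (a + q * x)) ->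
  matfun U g (a%:M + q *: A) =
  horner_mx A (herm rs (fun x j => q ^+ j * G j (a + q * x))).
Proof.
move=> oU tG gG sU.
rewrite (@matfun_herm _ _ _ (map (fun x => a + q * x) rs) _ _ U g G) //.
- rewrite horner_mx_affine; apply/esym.
  by apply: (dvdp_horner_mx rs0); exact: (herm_comp_affine a q rs (fun x j => G j x)).
- by rewrite horner_mx_affine nodal_comp_affine linearZ /= rs0 scaler0.
- move=> y /= /mapP[x xrs ->]; apply: spectrum_affine; rewrite -rsA; exact: xrs.
- move=> y /= /mapP[x xrs ->]; apply: sU; rewrite -rsA; exact: xrs.
Qed.

(** The inverse of v(A) is the interpolant of 1 / v at A. *)
Lemma horner_mx_unit (v : {poly C}) :
  (forall x, spectrum A x -> v.[x] != 0) -> horner_mx A v \in unitmx.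
Proof.
move=> vx.
have e : horner_mx A (v * herm rs (fun x j => rattower 1 v j x)) = 1.
  rewrite -(rmorph1 (horner_mx A)); apply: (dvdp_horner_mx rs0).
  apply: nodal_dvdP => x j jc; rewrite pjetB pjetM.
  have xrs : spectrum A x.
    by rewrite -rsA /= -has_pred1 has_count (leq_ltn_trans _ jc).
  rewrite (@leib_eq _ _ _ (rattower 1 v ^~ x)).
    by rewrite rat_leib ?subrr // vx.
  by move=> i ij; rewrite herm_jets // (leq_ltn_trans ij jc).
by rewrite rmorphM /= in e; have [] := mulmx1_unit e.
Qed.

End matrix.

(** The value of l is a finite sum of terms continuous in (t, mu). *)
Lemma bound_continuous (K : set C) (G : nat -> C -> C) (rs : seq C) (l : {poly C} -> C) :
  (forall p q, l (p + q) = l p + l q) -> (forall c p, l (c *: p) = c * l p) ->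
  (forall k x, K x -> {for x, continuous (G k)}) ->
  forall (t : R) (mu : C), (forall x, x \in rs -> K ((1 - t)%:C * mu + t%:C * x)) ->
  {for (t, mu), continuous (fun p : R * C =>
    cabs (l (herm rs (fun x j => p.1%:C ^+ j * G j ((1 - p.1)%:C * p.2 + p.1%:C * x)))))}.
Proof.
move=> lD lZ cG t mu hK; apply: (@continuous_cabs _ _ (fun p : R * C => l _)).
have -> : (fun p : R * C => l (herm rs (fun x j => p.1%:C ^+ j * G j ((1 - p.1)%:C * p.2 + p.1%:C * x)))) =
  (fun p => \sum_(i < size rs) p.1%:C ^+ (ordr rs i) *
      G (ordr rs i) ((1 - p.1)%:C * p.2 + p.1%:C * node rs i) * l (hbasis i)).
  apply/funext => p; rewrite /herm (l_sum lD lZ).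
  by apply: eq_bigr => i _; rewrite lZ.
have c1 : p.1 @[p --> (t, mu)] --> t by exact: (@cvg_fst _ _ (nbhs t) (nbhs mu)).
have c2 : p.2 @[p --> (t, mu)] --> mu by exact: (@cvg_snd _ _ (nbhs t) (nbhs mu)).
have c1' : p.1%:C @[p --> (t, mu)] --> (t%:C : C) by exact: cvgC_real.
have c3 : (1 - p.1)%:C @[p --> (t, mu)] --> ((1 - t)%:C : C).
  by apply: cvgC_real; apply: cvgB => //; exact: cvg_cst.
have cX j : p.1%:C ^+ j @[p --> (t, mu)] --> (t%:C ^+ j : C).
  elim: j => [|j ih]; first exact: cvg_cst.
  rewrite exprS (_ : (fun p : R * C => _) = fun p => p.1%:C * p.1%:C ^+ j); last first.
    by apply/funext => p; rewrite exprS.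
  exact: (cvgCM c1' ih).
elim: (index_enum _) => [|i s ih].
  rewrite (_ : (fun p : R * C => _) = fun=> 0); first exact: cst_continuous.
  by apply/funext => p; rewrite big_nil.
rewrite (_ : (fun p : R * C => _) = fun p => p.1%:C ^+ (ordr rs i) *
      G (ordr rs i) ((1 - p.1)%:C * p.2 + p.1%:C * node rs i) * l (hbasis i) +
   \sum_(i <- s) p.1%:C ^+ (ordr rs i) *
      G (ordr rs i) ((1 - p.1)%:C * p.2 + p.1%:C * node rs i) * l (hbasis i)); last first.
  by apply/funext => p; rewrite big_cons.
have ca : ((1 - p.1)%:C * p.2 + p.1%:C * node rs i) @[p --> (t, mu)]
    --> (1 - t)%:C * mu + t%:C * node rs i.
  exact: (cvgCD (cvgCM c3 c2) (cvgCM c1' (cvg_cst _))).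
have h1 : {for (t, mu), continuous (fun p : R * C =>
    G (ordr rs i) ((1 - p.1)%:C * p.2 + p.1%:C * node rs i))}.
  exact: (cvg_comp _ _ ca (cG (ordr rs i) _ (hK (node rs i) (mem_nth _ (ltn_ord i))))).
have h2 : {for (t, mu), continuous (fun p : R * C => l (hbasis i))}.
  exact: cst_continuous.
have h3 : {for (t, mu), continuous (fun p : R * C => p.1%:C ^+ (ordr rs i) : C)}.
  exact: cX.
exact: (contCD (contCM (contCM h3 h1) h2) ih).
Qed.

End main.

Unset Implicit Arguments.

Theorem corollary12 (R : realType) (n : nat) (A : 'M[R[i]]_n)
    (N : nat) (z : N.-tuple R[i])
    (U : set R[i]) (f : R[i] -> R[i])
    (L M : nat) (u v : {poly R[i]}) :
  open U ->
  convex_hull (spectrum A `|` [set` z]) `<=` U ->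
  analytic_on U f ->
  (size u <= L.+1)%N -> (size v <= M.+1)%N -> (L < N)%N ->
  interpolates z (ratfun u v) f ->
  (forall k : 'I_N, v.[tnth z k] != 0) ->
  (forall a, spectrum A a -> v.[a] != 0) ->
  forall b d : 'cV[R[i]]_n,
  let fA := matfun U f A in
  let rA := matfun [set a | v.[a] != 0] (ratfun u v) A in
  let OmegaA := matfun setT (fun a => (nodal_poly z).[a]) A in
  let vA := matfun setT (fun a => v.[a]) A in
  let bound (t : R) (mu : R[i]) : R[i] :=
    `| cform d
         (OmegaA *m invmx vA *m
          ((N`!)%:R^-1 *:
           matfun U (derive1n N (fun a => v.[a] * f a))
                  (((1 - t%:C) * mu)%:M + t%:C *: A))) b | in
  exists (t0 : R) (mu0 : R[i]),
    [/\ 0 <= t0 <= 1,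
        convex_hull [set` z] mu0,
        forall (t : R) (mu : R[i]), 0 <= t <= 1 -> convex_hull [set` z] mu ->
          bound t mu <= bound t0 mu0 &
        `| cform d (fA - rA) b | <= bound t0 mu0].
Proof.
move=> oU hU aU su _ LN interp vz vA b d.
have N0 : (0 < N)%N by exact: leq_ltn_trans LN.
have [c [s zcs]] : exists c s, tval z = c :: s.
  by case: z {interp vz hU} => -[|c s] /= zN; [rewrite -(eqP zN) in N0|exists c, s].
have zc : c \in tval z by rewrite zcs inE eqxx.
(* The matrix calculus above needs a nonzero size; for n = 0 the form vanishes. *)
case: n A hU vA b d => [|n] A hU vA b d fA rA OmegaA V bound.
  have c0 X : cform d X b = 0 by rewrite /cform mxE big_ord0.
  have b0 t mu : bound t mu = 0 by rewrite /bound c0 normr0.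
  exists 0, c; split.
  - by rewrite lexx ler01.
  - by apply: sub_hull; exact: zc.
  - by move=> t mu _ _; rewrite !b0.
  - by rewrite b0 c0 normr0.
have [rs [rs0 rsA]] := spectrum_nodal A.
pose K := convex_hull (spectrum A `|` [set` z]).
have cK : segment_closed K by exact: hull_segment_closed.
have rsK : [set` rs] `<=` K by move=> x xrs; apply: sub_hull; left; rewrite -rsA.
have zK : [set` z] `<=` K by move=> x xz; apply: sub_hull; right.
have hzK : convex_hull [set` z] `<=` K by exact: hull_sub.
pose F k := derive1n k f; have tF : tower U F by exact: analytic_tower.
pose G k x := leib (pjet v x) (F ^~ x) k.
have tG : tower U G by apply: tower_leib => //; exact: towerS (@tower_pjet _ v).
have tGK : tower K G by exact: towerS hU tG.
have zS : [set` z] = [set` c :: s] by apply/seteqP; split => x /=; rewrite -zcs.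
have ov := @open_horner_neq0 R v.
have vrs x : x \in rs -> v.[x] != 0 by move=> xrs; apply: vA; rewrite -rsA.
have fAE : fA = horner_mx A (herm rs (fun x j => F j x)).
  by apply: matfun_herm => //; [rewrite rsA|move=> x /rsK /hU].
have rAE : rA = horner_mx A (herm rs (fun x j => rattower u v j x)).
  apply: matfun_herm => //; [by rewrite rsA|exact: tower_rat].
have OE : OmegaA = horner_mx A (nodal z).
  by rewrite /OmegaA (matfun_poly rs0 rsA) /nodal big_tuple.
have VE : V = horner_mx A v by exact: (matfun_poly rs0 rsA).
have Vu : V \in unitmx by rewrite VE; exact: (horner_mx_unit rs0 rsA).
pose l p := cform d (OmegaA *m invmx V *m horner_mx A p) b.
have lD p q : l (p + q) = l p + l q by rewrite /l rmorphD mulmxDr cformD.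
have lZ k p : l (k *: p) = k * l p by rewrite /l linearZ -scalemxAr cformZ.
have l_rs p : nodal rs %| p -> l p = 0.
  move=> rp; have -> : p = 0 *: p + p by rewrite scale0r add0r.
  rewrite lD lZ mul0r add0r /l.
  have -> : horner_mx A p = 0.
    by rewrite -(rmorph0 (horner_mx A)); apply: (dvdp_horner_mx rs0); rewrite subr0.
  by rewrite mulmx0 /cform mulmx0 mul0mx mxE.
(* N! times the bound, with the matrix function replaced by an interpolant. *)
pose m (p : R * R[i]) := cabs (l (herm rs
  (fun x j => p.1%:C ^+ j * G (N + j)%N ((1 - p.1)%:C * p.2 + p.1%:C * x)))).
have boundE t mu : 0 <= t <= 1 -> convex_hull [set` z] mu ->
    bound t mu = (m (t, mu) / N`!%:R)%:C.
  move=> t01 /hzK Kmu.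
  have tC : (1 - t)%:C = 1 - t%:C :> R[i] by rewrite rmorphB rmorph1.
  pose J x j := t%:C ^+ j * G (N + j)%N ((1 - t%:C) * mu + t%:C * x).
  have e : matfun U (derive1n N (fun a => v.[a] * f a))
      (((1 - t%:C) * mu)%:M + t%:C *: A) = horner_mx A (herm rs J).
    apply: (matfun_affine rs0 rsA oU (G := fun k => G (N + k)%N)).
    - by move=> k x Ux; rewrite addnS; exact: tG.
    - move=> x Ux; rewrite addn0; apply: (tower_derive1n oU tG) => // y _.
      by rewrite /G /leib big_ord_recl big_ord0 addr0.
    - move=> x xA; apply: hU; rewrite -tC; apply: cK => //.
      by apply: rsK; rewrite rsA.
  have me : m (t, mu) = cabs (l (herm rs J)) by rewrite /m /= tC.
  have fE : (N`!%:R^-1)%:C = N`!%:R^-1 :> R[i] by rewrite fmorphV rmorph_nat.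
  rewrite /bound e -fE -scalemxAr cformZ -/(l _) normrM me rmorphM /= cabsE mulrC.
  by congr (_ * _); apply: ger0_norm; rewrite (lecR 0) invr_ge0.
clearbody bound.
have [[t0 mu0] tm0 max0] : exists2 p, p \in `[0, 1]%classic `*` convex_hull [set` z] &
    forall q, q \in `[0, 1]%classic `*` convex_hull [set` z] -> m q <= m p.
  apply: compact_EVT_max.
  - by exists (0, c); split; [rewrite /= in_itv /= lexx ler01|exact: sub_hull].
  - apply: compact_setX; first exact: segment_compact.
    by rewrite zS hullE; exact: compact_join_hull.
  - apply: continuous_in_subspaceT => -[t mu] /set_mem [/=]; rewrite in_itv => t01 hmu.
    apply: (@bound_continuous _ K (fun k => G (N + k)%N)) => //.
      by move=> k x Kx; apply: (is_deriveC_continuous (tGK _ _ Kx)).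
    by move=> x xrs; apply: cK => //; [exact: hzK|exact: rsK].
have [t001 hmu0] : 0 <= t0 <= 1 /\ convex_hull [set` z] mu0.
  by move/set_mem: tm0 => [/=]; rewrite in_itv.
have f0 : 0 < N`!%:R :> R by rewrite ltr0n fact_gt0.
exists t0, mu0; split; [exact: t001|exact: hmu0| |].
  move=> t mu t01 hmu; rewrite (boundE t mu t01 hmu) (boundE t0 mu0 t001 hmu0).
  have h : m (t, mu) <= m (t0, mu0).
    by apply: max0; apply/mem_set; split => //=; rewrite in_itv.
  by rewrite lecR; apply: ler_wpM2r h; rewrite invr_ge0 ltW.
rewrite (boundE t0 mu0 t001 hmu0) -cabsE lecR.
have -> : cform d (fA - rA) b = ddiff rs l z (fun x j => G j x).
  pose P := herm (z ++ rs) (fun x j => G j x).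
  have hP x j : (j < count_mem x z + count_mem x rs)%N -> pjet P x j = G j x.
    by move=> jc; apply: herm_jets; rewrite count_cat.
  have hfA : V *m fA = horner_mx A P.
    have e : horner_mx A (v * herm rs (fun x j => F j x)) = horner_mx A P.
      apply: (dvdp_horner_mx rs0); apply: nodal_dvdP => x j jc.
      rewrite pjetB pjetM hP; last by rewrite (leq_trans jc) // leq_addl.
      rewrite (@leib_eq _ _ _ (F ^~ x)) ?subrr // => i ij.
      by rewrite herm_jets // (leq_ltn_trans ij jc).
    by rewrite VE fAE -e rmorphM.
  have hrA : V *m rA = horner_mx A u.
    have e : horner_mx A (v * herm rs (fun x j => rattower u v j x)) = horner_mx A u.
      apply: (dvdp_horner_mx rs0); apply: nodal_dvdP => x j jc.
      rewrite pjetB pjetM (@leib_eq _ _ _ (rattower u v ^~ x)); last first.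
        by move=> i ij; rewrite herm_jets // (leq_ltn_trans ij jc).
      by rewrite rat_leib ?subrr // vrs // -has_pred1 has_count (leq_ltn_trans _ jc).
    by rewrite VE rAE -e rmorphM.
  have /dvdpP[k Pu] : nodal z %| P - u.
    apply: nodal_dvdP => x j jc; rewrite pjetB hP; last by rewrite (leq_trans jc) // leq_addr.
    have vx : v.[x] != 0.
      have /tnthP[i ->] : x \in z by rewrite -has_pred1 has_count (leq_ltn_trans _ jc).
      exact: vz.
    rewrite -(rat_leib u j vx) /G (@leib_eq _ _ _ (rattower u v ^~ x)) ?subrr // => i ij.
    rewrite /F -(interp x i (leq_ltn_trans ij jc)).
    by apply: (tower_derive1n ov (@tower_rat _ u v)) => // y _; rewrite /rattower expr1.
  have -> : ddiff rs l z (fun x j => G j x) = l k.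
    rewrite /ddiff -/P -[P](subrK u) Pu divp_addl_mul_small //.
    by rewrite size_nodal size_tuple ltnS (leq_trans su).
  rewrite /l; congr cform.
  have hk : V *m (fA - rA) = OmegaA *m horner_mx A k.
    by rewrite mulmxBr hfA hrA -rmorphB Pu OE -[RHS]rmorphM mulrC.
  have comm : invmx V *m OmegaA = OmegaA *m invmx V.
    have VO : V *m OmegaA = OmegaA *m V.
      by rewrite VE OE -[LHS]rmorphM -[RHS]rmorphM mulrC.
    by rewrite -[LHS](mulmxK Vu) -[_ *m V]mulmxA -VO mulKmx.
  by rewrite -[LHS](mulKmx Vu) hk mulmxA comm.
have := @ddiff_bound _ rs l lD lZ l_rs K cK rsK z G (m (t0, mu0)) zK tGK.
rewrite size_tuple; apply => t w.
rewrite [X in simplex_set X]zcs => /simplex_setP [t01 [mu hmu ->]].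
apply: (max0 (t, mu)); apply/mem_set; split => /=; first by rewrite in_itv.
by rewrite zS.
Qed.
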